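(* Consider a reward-learning problem $(\mathcal F,g)$ as described in the context: $g$ is the application of assessing a preference between $\pi^1$ and $\pi^2$, and $\mathcal F$ consists of $m_{D}$ suboptimal-expert demonstrations, $m_{TC}$ trajectory comparisons and $m_{PC}$ policy comparisons, with unknown target reward $r^\star\in\mathcal R_{\mathcal F}$. Assume Slater's condition: there exist $\xi>0$ and $\overline r\in\mathfrak R$ such that $$\max_\pi J^\pi(\overline r;p_{D,i})-\langle d^{\pi_{D,i}},\overline r\rangle-t_i\le-\xi\ \ \forall i\in[m_D],$$ $$\langle d^{\omega^1_{TC,i}}-d^{\omega^2_{TC,i}},\overline r\rangle\le-\xi\ \ \forall i\in[m_{TC}],\qquad \langle d^{\pi^1_{PC,i}}-d^{\pi^2_{PC,i}},\overline r\rangle\le-\xi\ \ \forall i\in[m_{PC}].$$ Let $\epsilon\in(0,2H]$ and $\delta\in(0,1)$. If $$s=\frac{4H}{\xi}+\sqrt{\Big(\frac{4H}{\xi}\Big)^2+\frac{SAH}{4}},\qquad \alpha=\frac{\epsilon}{16H\,(1+s\sqrt{m_D+m_{TC}+m_{PC}})^2},$$ then, with probability at least $1-\delta$, the outputs $\widehat x_K,\widehat{\mathcal I}_K$ of the algorithm Rob-ReL satisfy $$\mathcal L_g(r^\star,\widehat x_K)\le\mathcal I_{\mathcal F,g}+\epsilon\quad\text{and}\quad \big|\mathcal I_{\mathcal F,g}-\widehat{\mathcal I}_K\big|\le\epsilon,$$ with a number of samples $$n^1,n^2,n_{D,i},n^1_{PC,i},n^2_{PC,i}\le\widetilde{\mathcal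 O}\Big(\frac{SAH^5}{\epsilon^2\xi^2}\log\frac1\delta\Big),$$ $$N_{D,i}\le\widetilde{\mathcal O}\Big(\frac{SAH^5}{\epsilon^2\xi^2}\Big(S+\log\frac1\delta\Big)\Big),\qquad N,N_{TC,i},N_{PC,i}=0,$$ and a number of iterations $$K\le\mathcal O\Bigg(\frac{H^{5/2}}{\xi\epsilon^2}\Big(\sqrt{SA}+\frac{\sqrt H}{\xi}\Big)\Big(1+\sqrt{H(m_D+m_{TC}+m_{PC})\Big(\frac H{\xi^2}+SA\Big)}\Big)^2\Bigg).$$
   Context: **Basic notation.** $\mathcal S,\mathcal A$ are finite sets with $S=|\mathcal S|$, $A=|\mathcal A|$; $H\in\mathbb N$; $[N]=\{1,\dots,N\}$. $\mathfrak R=\{r:\mathcal S\times\mathcal A\times[H]\to[0,1]\}$ is the set of rewards, viewed as vectors in $\mathbb R^{SAH}$ with the dot product $\langle\cdot,\cdot\rangle$. An MDP without reward is $(\mathcal S,\mathcal A,H,s_0,p)$ with initial state $s_0$ and (time-dependent) transition model $p$. A policy $\pi$ assigns to each $(s,h)\in\mathcal S\times[H]$ a distribution on $\mathcal A$. $d^\pi_h(s,a)$ is the probability that $(s_h,a_h)=(s,a)$ when $\pi$ is run from $s_0$ under $p$; $J^\pi(r;p)=\langle d^\pi,r\rangle$ is the expected return; $J^*(r;p)=\max_\pi J^\pi(r;p)$. For a trajectory $\omega=(s_1,a_1,\dots,s_H,a_H,s_{H+1})$, $d^\omega_h(s,a)=\mathbb 1\{s_h=s,a_h=a\}$ and its return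 is $G(\omega;r)=\langle d^\omega,r\rangle$. $\Pi_{\mathcal Y}$ denotes Euclidean projection onto $\mathcal Y$. **The problem.** There is a target MDP without reward $\mathcal M=(\mathcal S,\mathcal A,H,s_0,p)$ and two policies $\pi^1,\pi^2$ in it. For $r\in\mathfrak R$, $x\in\mathbb R$ the loss is $\mathcal L_g(r,x)=|x-(J^{\pi^1}(r;p)-J^{\pi^2}(r;p))|$. The feedback is: (D) for $i\in[m_D]$, an MDP without reward $\mathcal M_{D,i}=(\mathcal S,\mathcal A,H,s_{0,D,i},p_{D,i})$, a policy $\pi_{D,i}$ and $t_i\in[0,H]$; (TC) for $i\in[m_{TC}]$, a pair of known trajectories $\omega^1_{TC,i},\omega^2_{TC,i}$ of an MDP without reward $\mathcal M_{TC,i}=(\mathcal S,\mathcal A,H,s_{0,TC,i},p_{TC,i})$; (PC) for $i\in[m_{PC}]$, a pair of policies $\pi^1_{PC,i},\pi^2_{PC,i}$ in an MDP without reward $\mathcal M_{PC,i}=(\mathcal S,\mathcal A,H,s_{0,PC,i},p_{PC,i})$; here $m_D,m_{TC},m_{PC}\ge0$. The feasible set $\mathcal R_{\mathcal F}$ is the set of all $r\in\mathfrak R$ with $\max_\pi J^\pi(r;p_{D,i})-\langle d^{\pi_{D,i}},r\rangle\le t_i$ for all $i\in[m_D]$, $\langle d^{\omega^1_{TC,i}}-d^{\omega^2_{TC,i}},r\rangle\le0$ for all $i\in[m_{TC}]$, $\langle d^{\pi^1_{PC,i}}-d^{\pi^2_{PC,i}},r\rangle\le0$ for all $i\in[m_{PC}]$,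 each $d$ and $J$ being computed in the corresponding MDP. The target reward $r^\star$ is unknown, with $r^\star\in\mathcal R_{\mathcal F}$. The uninformativeness is $\mathcal I_{\mathcal F,g}=\min_{x\in\mathbb R}\max_{r\in\mathcal R_{\mathcal F}}\mathcal L_g(r,x)$. **Data access.** Policies and transition models are unknown. One has datasets of $n^1,n^2$ i.i.d. trajectories of $\pi^1,\pi^2$ in $\mathcal M$, $n_{D,i}$ of $\pi_{D,i}$ in $\mathcal M_{D,i}$, and $n^1_{PC,i},n^2_{PC,i}$ of $\pi^1_{PC,i},\pi^2_{PC,i}$ in $\mathcal M_{PC,i}$. One can also collect $N,N_{D,i},N_{TC,i},N_{PC,i}$ exploration trajectories, with policies of one's choice, from $\mathcal M,\mathcal M_{D,i},\mathcal M_{TC,i},\mathcal M_{PC,i}$ respectively. **Algorithm Rob-ReL.** (1) Estimate each visitation distribution $d^\pi$ from its dataset of $n$ trajectories by empirical frequencies $\widehat d^\pi_h(s,a)=\frac1n\sum_{j=1}^n\mathbb 1\{s^j_h=s,a^j_h=a\}$. (2) For each $i\in[m_D]$, run the reward-free exploration algorithm RF-Express (Ménard et al., ICML 2021) for $N_{D,i}$ trajectories in $\mathcal M_{D,i}$ to get an estimate $\widehat p_{D,i}$ of $p_{D,i}$. RF-Express is used as a black box with the following known guarantee: for accuracy $\epsilon'$ and confidence $\delta'$, with $\widetilde{\mathcal O}\big(\frac{SAH^3}{\epsilon'^2}(S+\log\frac1{\delta'})\big)$ trajectories it returns $\widehat p_{D,i}$ such that $\sup_{r\in\mathfrak R}|\max_\pi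 J^\pi(r;\widehat p_{D,i})-J^*(r;p_{D,i})|\le\epsilon'$ with probability at least $1-\delta'$. (3) For $r\in\mathfrak R$ and $\lambda=(\lambda_D,\lambda_{TC},\lambda_{PC})\in\mathbb R^{m_D+m_{TC}+m_{PC}}$ let $$\widehat L(r,\lambda)=\langle\widehat d^{\pi^1}-\widehat d^{\pi^2},r\rangle+\sum_i\lambda_D^i\big(\max_\pi J^\pi(r;\widehat p_{D,i})-\langle\widehat d^{\pi_{D,i}},r\rangle-t_i\big)+\sum_i\lambda_{TC}^i\langle d^{\omega^1_{TC,i}}-d^{\omega^2_{TC,i}},r\rangle+\sum_i\lambda_{PC}^i\langle\widehat d^{\pi^1_{PC,i}}-\widehat d^{\pi^2_{PC,i}},r\rangle.$$ $\partial_\lambda\widehat L(r,\lambda)$ is the gradient in $\lambda$, and $$\partial_r\widehat L(r,\lambda)=\widehat d^{\pi^1}-\widehat d^{\pi^2}+\sum_i\lambda_D^i\big(d^{\widehat\pi^{r,*}_{D,i}}-\widehat d^{\pi_{D,i}}\big)+\sum_i\lambda_{TC}^i\big(d^{\omega^1_{TC,i}}-d^{\omega^2_{TC,i}}\big)+\sum_i\lambda_{PC}^i\big(\widehat d^{\pi^1_{PC,i}}-\widehat d^{\pi^2_{PC,i}}\big),$$ where $\widehat\pi^{r,*}_{D,i}$ is any policy maximizing $J^\pi(r;\widehat p_{D,i})$ and $d^{\widehat\pi^{r,*}_{D,i}}$ is its visitation distribution under $\widehat p_{D,i}$ from $s_{0,D,i}$. (4) PDSM-MAX, with step size $\alpha>0$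 and radius $s$: set $r_0=0$, $\lambda_0=0$, $\mathfrak D_-=\{\lambda\le0:\|\lambda\|_2\le s\}$, and iterate $r_{k+1}=\Pi_{\mathfrak R}(r_k+\alpha\,\partial_r\widehat L(r_k,\lambda_k))$, $\lambda_{k+1}=\Pi_{\mathfrak D_-}(\lambda_k-\alpha\,\partial_\lambda\widehat L(r_k,\lambda_k))$; return $\widehat M_K=\langle\widehat d^{\pi^1}-\widehat d^{\pi^2},\widehat r_K\rangle$ with $\widehat r_K=\frac1K\sum_{k=0}^{K-1}r_k$. PDSM-MIN is the same with $\mathfrak D_+=\{\lambda\ge0:\|\lambda\|_2\le s\}$ in place of $\mathfrak D_-$ and with both update signs reversed; it returns $\widehat m_K$. (5) Output $\widehat x_K=(\widehat M_K+\widehat m_K)/2$ and $\widehat{\mathcal I}_K=(\widehat M_K-\widehat m_K)/2$. **Asymptotic notation.** $\mathcal O$ hides a universal constant; $\widetilde{\mathcal O}$ additionally hides logarithmic factors in $S,A,H,1/\epsilon,1/\xi,m_D,m_{TC},m_{PC}$ (and lower-order logarithmic factors). The bounds mean that such numbers of samples and iterations suffice.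
   Formalization: The first sample bound has 1+log(1/δ) for log(1/δ) (which fails as δ→1); if m_D+m_TC+m_PC=0, ξ≤H is assumed (Slater is then vacuous); the bound on K carries an extra factor max(1, ξ√(SA/H)), without which it fails when ξ²SA is much larger than H. *)

(* Defs.v *)
From HB Require Import structures.
From mathcomp Require Import all_boot all_order all_algebra.
From mathcomp Require Import all_classical all_reals all_analysis.
Set Implicit Arguments.
Unset Strict Implicit.
Unset Printing Implicit Defensive.
Import Order.TTheory GRing.Theory Num.Theory.
Local Open Scope classical_set_scope.
Local Open Scope ring_scope.

(* Euclidean space R^T over a finite index type T *)

Notation vec R T := {ffun T -> R}.

Definition dot (R : realType) (T : finType) (u v : vec R T) : R :=
  \sum_x u x * v x.

Definition enorm (R : realType) (T : finType) (u : vec R T) : R :=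
  Num.sqrt (dot u u).

(* A point of Y closest to v; it is unique for the closed convex nonempty sets
   used below. *)
Definition eproj (R : realType) (T : finType) (Y : set (vec R T))
    (v : vec R T) : vec R T :=
  xget v [set y | Y y /\ forall z, Y z -> enorm (v - y) <= enorm (v - z)].

(* Finite probability *)

Record fdist (R : realType) (T : finType) := FDist {
  fdist_fun :> T -> R;
  fdist_ge0 : forall x, 0 <= fdist_fun x;
  fdist_sum1 : \sum_x fdist_fun x = 1 }.

(* Probability of the event E under the mass function mu *)
Definition pr (R : realType) (T : finType) (mu : T -> R) (E : T -> Prop) : R :=
  \sum_(w | `[< E w >]) mu w.

(* Markov decision processes. Steps 1, ..., H are the elements 0, ..., H - 1
   of 'I_H. *)

Definition policy (R : realType) (S A : finType) (H : nat) :=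
  S -> 'I_H -> fdist R A.

Definition tmodel (R : realType) (S A : finType) (H : nat) :=
  'I_H -> S -> A -> fdist R S.

Record mdp (R : realType) (S A : finType) (H : nat) := MDP {
  init : S;
  trans : tmodel R S A H }.

(* (s_1, a_1, ..., s_H, a_H, s_(H+1)), as the pair of its states and actions *)
Definition traj (S A : finType) (H : nat) : finType :=
  ({ffun 'I_H.+1 -> S} * {ffun 'I_H -> A})%type.

Definition state_at (S A : finType) (H : nat) (w : traj S A H) (h : 'I_H) : S :=
  w.1 (widen_ord (leqnSn H) h).

Definition next_state (S A : finType) (H : nat) (w : traj S A H) (h : 'I_H) :
    S :=
  w.1 (lift ord0 h).

Definition action_at (S A : finType) (H : nat) (w : traj S A H) (h : 'I_H) :
    A :=
  w.2 h.

(* Probability of the trajectory w when pi is run in M *)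
Definition traj_pr (R : realType) (S A : finType) (H : nat) (M : mdp R S A H)
    (pi : policy R S A H) (w : traj S A H) : R :=
  (w.1 ord0 == init M)%:R *
  \prod_(h < H) (pi (state_at w h) h (action_at w h) *
                 trans M h (state_at w h) (action_at w h) (next_state w h)).

Definition reward (R : realType) (S A : finType) (H : nat) :=
  vec R (S * A * 'I_H)%type.

Definition rewards (R : realType) (S A : finType) (H : nat) :
    set (reward R S A H) :=
  [set r | forall x, 0 <= r x <= 1].

(* d^omega *)
Definition visit_traj (R : realType) (S A : finType) (H : nat)
    (w : traj S A H) : reward R S A H :=
  [ffun x => let: (s, a, h) := x in
     ((state_at w h == s) && (action_at w h == a))%:R].

(* d^pi in M *)
Definition visit (R : realType) (S A : finType) (H : nat) (M : mdp R S A H)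
    (pi : policy R S A H) : reward R S A H :=
  [ffun x => let: (s, a, h) := x in
     pr (traj_pr M pi) (fun w => state_at w h = s /\ action_at w h = a)].

Definition J (R : realType) (S A : finType) (H : nat) (M : mdp R S A H)
    (pi : policy R S A H) (r : reward R S A H) : R :=
  dot (visit M pi) r.

Definition Jstar (R : realType) (S A : finType) (H : nat) (M : mdp R S A H)
    (r : reward R S A H) : R :=
  sup [set J M pi r | pi in setT].

(* Asymptotic notation: y up to the constant C and the k-th power of the
   logarithms of the quantities xs. Both \tilde O and O are rendered by
   quantifying existentially over C (and k) before all problem parameters. *)
Definition softO (R : realType) (C : R) (k : nat) (xs : seq R) (y : R) : R :=
  C * y * (1 + \sum_(x <- xs) ln (1 + x)) ^+ k.

(* Reward-free exploration. An algorithm knows the initial state; for accuracy e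
   and confidence d it collects rfe_num e d trajectories, choosing the policy
   of each from the list of those already collected, and returns a transition
   model. *)

Record rfe_alg (R : realType) (S A : finType) (H : nat) := RFE {
  rfe_num : R -> R -> nat;
  rfe_explore : R -> R -> S -> seq (traj S A H) -> policy R S A H;
  rfe_out : R -> R -> S -> seq (traj S A H) -> tmodel R S A H }.

(* Law of the N trajectories collected in M *)
Definition rfe_pr (R : realType) (S A : finType) (H : nat)
    (alg : rfe_alg R S A H) (e d : R) (M : mdp R S A H) (N : nat)
    (w : N.-tuple (traj S A H)) : R :=
  \prod_(j < N)
    traj_pr M (rfe_explore alg e d (init M) (take j w)) (tnth w j).

(* M with its transition model replaced by the estimated one *)
Definition rfe_mdp (R : realType) (S A : finType) (H : nat)
    (alg : rfe_alg R S A H) (e d : R) (M : mdp R S A H)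
    (w : seq (traj S A H)) : mdp R S A H :=
  MDP (init M) (rfe_out alg e d (init M) w).

Definition rfe_guarantee (R : realType) (S A : finType) (H : nat) (C : R)
    (k : nat) (alg : rfe_alg R S A H) : Prop :=
  forall e d : R, 0 < e -> 0 < d < 1 ->
    (rfe_num alg e d)%:R
      <= softO C k [:: #|S|%:R; #|A|%:R; H%:R; e^-1; ln d^-1]
           (#|S|%:R * #|A|%:R * H%:R ^+ 3 / e ^+ 2 * (#|S|%:R + ln d^-1)) /\
    forall M : mdp R S A H,
      1 - d <= pr (rfe_pr alg e d M (N := rfe_num alg e d))
                 (fun w => sup [set `|Jstar (rfe_mdp alg e d M w) r - Jstar M r|
                               | r in @rewards R S A H] <= e).

(* The reward-learning problem *)

Record problem (R : realType) (S A : finType) (H mD mTC mPC : nat) :=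
  Problem {
    tgt : mdp R S A H;
    tgt_pol1 : policy R S A H;
    tgt_pol2 : policy R S A H;
    D_mdp : 'I_mD -> mdp R S A H;
    D_pol : 'I_mD -> policy R S A H;
    D_t : 'I_mD -> R;
    D_t_range : forall i, 0 <= D_t i <= H%:R;
    TC_mdp : 'I_mTC -> mdp R S A H;
    TC_traj1 : 'I_mTC -> traj S A H;
    TC_traj2 : 'I_mTC -> traj S A H;
    PC_mdp : 'I_mPC -> mdp R S A H;
    PC_pol1 : 'I_mPC -> policy R S A H;
    PC_pol2 : 'I_mPC -> policy R S A H }.

(* The policies of which a dataset is available, with false for the first and
   true for the second policy of a pair: those of the target MDP, the
   demonstrators, and those of the policy comparisons *)
Definition source (mD mPC : nat) : finType :=
  (bool + 'I_mD + 'I_mPC * bool)%type.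

Definition src_tgt (mD mPC : nat) (b : bool) : source mD mPC := inl (inl b).
Definition src_D (mD mPC : nat) (i : 'I_mD) : source mD mPC := inl (inr i).
Definition src_PC (mD mPC : nat) (i : 'I_mPC) (b : bool) : source mD mPC :=
  inr (i, b).

Definition src_mdp (R : realType) (S A : finType) (H mD mTC mPC : nat)
    (P : problem R S A H mD mTC mPC) (q : source mD mPC) : mdp R S A H :=
  match q with
  | inl (inl _) => tgt P
  | inl (inr i) => D_mdp P i
  | inr (i, _) => PC_mdp P i
  end.

Definition src_pol (R : realType) (S A : finType) (H mD mTC mPC : nat)
    (P : problem R S A H mD mTC mPC) (q : source mD mPC) : policy R S A H :=
  match q with
  | inl (inl b) => if b then tgt_pol2 P else tgt_pol1 P
  | inl (inr i) => D_pol P i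
  | inr (i, b) => if b then PC_pol2 P i else PC_pol1 P i
  end.

Definition src_visit (R : realType) (S A : finType) (H mD mTC mPC : nat)
    (P : problem R S A H mD mTC mPC) (q : source mD mPC) : reward R S A H :=
  visit (src_mdp P q) (src_pol P q).

(* Index of a feedback, hence of a constraint on the reward *)
Definition feedback (mD mTC mPC : nat) : finType :=
  ('I_mD + 'I_mTC + 'I_mPC)%type.

(* Left-hand sides of the constraints (in the form "<= 0") for visitation
   distributions dv and demonstration MDPs MD, which are either the true ones
   or their estimates. In the latter case this is also the gradient in lambda
   of the empirical Lagrangian, which is affine in lambda. *)
Definition constr (R : realType) (S A : finType) (H mD mTC mPC : nat)
    (P : problem R S A H mD mTC mPC) (dv : source mD mPC -> reward R S A H)
    (MD : 'I_mD -> mdp R S A H) (r : reward R S A H) :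
    vec R (feedback mD mTC mPC) :=
  [ffun c => match c with
   | inl (inl i) => Jstar (MD i) r - dot (dv (src_D mPC i)) r - D_t P i
   | inl (inr i) =>
       dot (visit_traj R (TC_traj1 P i) - visit_traj R (TC_traj2 P i)) r
   | inr i => dot (dv (src_PC mD i false) - dv (src_PC mD i true)) r
   end].

Definition feasible (R : realType) (S A : finType) (H mD mTC mPC : nat)
    (P : problem R S A H mD mTC mPC) : set (reward R S A H) :=
  [set r | @rewards R S A H r /\
           forall c, constr P (src_visit P) (D_mdp P) r c <= 0].

Definition slater (R : realType) (S A : finType) (H mD mTC mPC : nat)
    (P : problem R S A H mD mTC mPC) (xi : R) : Prop :=
  exists2 rbar, @rewards R S A H rbar &
    forall c, constr P (src_visit P) (D_mdp P) rbar c <= - xi.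

Definition loss (R : realType) (S A : finType) (H mD mTC mPC : nat)
    (P : problem R S A H mD mTC mPC) (r : reward R S A H) (x : R) : R :=
  `|x - (J (tgt P) (tgt_pol1 P) r - J (tgt P) (tgt_pol2 P) r)|.

Definition uninformativeness (R : realType) (S A : finType)
    (H mD mTC mPC : nat) (P : problem R S A H mD mTC mPC) : R :=
  inf [set sup [set loss P r x | r in feasible P] | x in setT].

(* Rob-ReL *)

(* Any way of choosing an optimal policy *)
Definition optimal_planner (R : realType) (S A : finType) (H : nat)
    (plan : mdp R S A H -> reward R S A H -> policy R S A H) : Prop :=
  forall M r, @rewards R S A H r -> J M (plan M r) r = Jstar M r.

Definition obj_grad (R : realType) (S A : finType) (H mD mPC : nat)
    (dv : source mD mPC -> reward R S A H) : reward R S A H :=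
  dv (src_tgt mD mPC false) - dv (src_tgt mD mPC true).

(* The subgradient in r of the empirical Lagrangian *)
Definition lagr_grad_r (R : realType) (S A : finType) (H mD mTC mPC : nat)
    (P : problem R S A H mD mTC mPC)
    (plan : mdp R S A H -> reward R S A H -> policy R S A H)
    (dv : source mD mPC -> reward R S A H) (MD : 'I_mD -> mdp R S A H)
    (r : reward R S A H) (l : vec R (feedback mD mTC mPC)) : reward R S A H :=
  obj_grad dv
  + \sum_(i < mD) l (inl (inl i)) *:
      (visit (MD i) (plan (MD i) r) - dv (src_D mPC i))
  + \sum_(i < mTC) l (inl (inr i)) *:
      (visit_traj R (TC_traj1 P i) - visit_traj R (TC_traj2 P i))
  + \sum_(i < mPC) l (inr i) *:
      (dv (src_PC mD i false) - dv (src_PC mD i true)).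

(* Below, b = false stands for PDSM-MAX and b = true for PDSM-MIN. *)

Definition multipliers (R : realType) (T : finType) (b : bool) (s : R) :
    set (vec R T) :=
  [set l : vec R T |
     (forall c, if b then 0 <= l c else l c <= 0) /\ enorm l <= s].

Definition pdsm_step (R : realType) (S A : finType) (H mD mTC mPC : nat)
    (P : problem R S A H mD mTC mPC)
    (plan : mdp R S A H -> reward R S A H -> policy R S A H)
    (dv : source mD mPC -> reward R S A H) (MD : 'I_mD -> mdp R S A H)
    (alpha s : R) (b : bool)
    (rl : reward R S A H * vec R (feedback mD mTC mPC)) :
    reward R S A H * vec R (feedback mD mTC mPC) :=
  let a := if b then - alpha else alpha in
  (eproj (@rewards R S A H)
     (rl.1 + a *: lagr_grad_r P plan dv MD rl.1 rl.2),
   eproj (@multipliers R (feedback mD mTC mPC) b s)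
     (rl.2 - a *: constr P dv MD rl.1)).

Definition pdsm (R : realType) (S A : finType) (H mD mTC mPC : nat)
    (P : problem R S A H mD mTC mPC)
    (plan : mdp R S A H -> reward R S A H -> policy R S A H)
    (dv : source mD mPC -> reward R S A H) (MD : 'I_mD -> mdp R S A H)
    (alpha s : R) (K : nat) (b : bool) : R :=
  let it k := iter k (pdsm_step P plan dv MD alpha s b) (0, 0) in
  dot (obj_grad dv) (K%:R^-1 *: \sum_(k < K) (it k).1).

(* Everything that is observed at random: n q trajectories of every policy q,
   and N exploration trajectories in every demonstration MDP. Nothing is
   explored in the other MDPs. *)
Definition sample (S A : finType) (H mD mPC : nat) (n : source mD mPC -> nat)
    (N : nat) : finType :=
  ({ffun {q : source mD mPC & 'I_(n q)} -> traj S A H} *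
   {ffun 'I_mD -> N.-tuple (traj S A H)})%type.

Definition sample_pr (R : realType) (S A : finType) (H mD mTC mPC : nat)
    (P : problem R S A H mD mTC mPC) (alg : rfe_alg R S A H) (e d : R)
    (n : source mD mPC -> nat) (N : nat) (w : sample S A H n N) : R :=
  (\prod_(j : {q : source mD mPC & 'I_(n q)})
     traj_pr (src_mdp P (tag j)) (src_pol P (tag j)) (w.1 j)) *
  \prod_(i < mD) rfe_pr alg e d (D_mdp P i) (w.2 i).

Definition emp_visit (R : realType) (S A : finType) (H mD mPC : nat)
    (n : source mD mPC -> nat) (N : nat) (w : sample S A H n N)
    (q : source mD mPC) : reward R S A H :=
  (n q)%:R^-1 *:
    \sum_(j < n q)
       visit_traj R (w.1 (Tagged (fun q => 'I_(n q)) j)).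

Definition emp_mdp (R : realType) (S A : finType) (H mD mTC mPC : nat)
    (P : problem R S A H mD mTC mPC) (alg : rfe_alg R S A H) (e d : R)
    (n : source mD mPC -> nat) (N : nat) (w : sample S A H n N) (i : 'I_mD) :
    mdp R S A H :=
  rfe_mdp alg e d (D_mdp P i) (w.2 i).

Definition robrel_pdsm (R : realType) (S A : finType) (H mD mTC mPC : nat)
    (P : problem R S A H mD mTC mPC)
    (plan : mdp R S A H -> reward R S A H -> policy R S A H)
    (alg : rfe_alg R S A H) (e d alpha s : R) (K : nat)
    (n : source mD mPC -> nat) (N : nat) (w : sample S A H n N) (b : bool) :
    R :=
  pdsm P plan (emp_visit R w) (emp_mdp P alg e d w) alpha s K b.

Definition robrel_x (R : realType) (S A : finType) (H mD mTC mPC : nat)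
    (P : problem R S A H mD mTC mPC)
    (plan : mdp R S A H -> reward R S A H -> policy R S A H)
    (alg : rfe_alg R S A H) (e d alpha s : R) (K : nat)
    (n : source mD mPC -> nat) (N : nat) (w : sample S A H n N) : R :=
  (robrel_pdsm P plan alg e d alpha s K w false
   + robrel_pdsm P plan alg e d alpha s K w true) / 2.

Definition robrel_I (R : realType) (S A : finType) (H mD mTC mPC : nat)
    (P : problem R S A H mD mTC mPC)
    (plan : mdp R S A H -> reward R S A H -> policy R S A H)
    (alg : rfe_alg R S A H) (e d alpha s : R) (K : nat)
    (n : source mD mPC -> nat) (N : nat) (w : sample S A H n N) : R :=
  (robrel_pdsm P plan alg e d alpha s K w false
   - robrel_pdsm P plan alg e d alpha s K w true) / 2.

Definition iter_bound (R : realType) (S A H m eps xi : R) : R :=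
  H `^ (5 / 2) / (xi * eps ^+ 2) * (Num.sqrt (S * A) + Num.sqrt H / xi)
  * (1 + Num.sqrt (H * m * (H / xi ^+ 2 + S * A))) ^+ 2.

(* The expression iter_bound is the leading order of the number of iterations
   as xi tends to 0: the distance from the initial reward also contributes
   H^2 * S * A / eps^2 times the last factor of iter_bound, which iter_bound
   dominates only if xi^2 * S * A <= H. In that range this correction is 1. *)
Definition slack_factor (R : realType) (S A H xi : R) : R :=
  Num.max 1 (xi * Num.sqrt (S * A / H)).

(* Main.v *)
Require Import Defs.
From mathcomp Require Import all_boot all_order all_algebra.
From mathcomp Require Import all_classical all_reals all_analysis.
From mathcomp Require Import ring lra.
Set Implicit Arguments.
Unset Strict Implicit.
Unset Printing Implicit Defensive.
Import Order.TTheory GRing.Theory Num.Theory.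
Local Open Scope classical_set_scope.
Local Open Scope ring_scope.

(** Assessing the preference amounts to knowing the extreme values of
   f(r) = <d^pi1 - d^pi2, r> over the feasible rewards: the uninformativeness is
   half their difference and the best guess is their midpoint.  It thus suffices
   that each of the two PDSM runs approximates its extreme value up to eps.

   No duality is used.  Telescoping the squared distances of the iterates to a
   reference pair (z, nu), where z satisfies the empirical constraints, bounds
   f(rbar) - f(z) + <nu, g(rbar)> for the averaged reward rbar.  Taking nu = 0
   bounds f(rbar) from one side; taking nu to be s times a basis vector bounds the
   violation of each constraint at rbar.  Since violations are repaired by mixing
   with the Slater point at a cost proportional to 2H / xi, and s >= 8H / xi, this
   violation bound yields the other side.

   The statistical error enters only through sup_r |<d^hat - d, r>| over r in
   [0,1]^SAH.  This supremum is attained at indicators of sets, so an exponential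
   inequality and a union bound over the 2^SAH sets suffice. *)

(** * Euclidean geometry and projections *)

(** Both runs are treated as one: with [sg] equal to 1 for PDSM-MIN and -1 for PDSM-MAX, each
    minimizes [sg] times f, and [sg] times its multipliers is nonnegative. The obstacle is that the
    violation bound at rbar contains f(rbar) itself: in the minimizing case it is (gap - (f(rbar) -
    f(z))) / s, which is large exactly when f(rbar) is far too small. As f oscillates by at most 2H,
    s >= 8H / xi keeps the cost of repairing this violation below a quarter of the numerator, so the
    unknown reappears with coefficient 1/4 and is absorbed. The Slater point is used in both
    directions, since z must satisfy the estimated constraints while the optimal value refers to the
    exact ones. The optimal value itself enters through a point within eps / 32 of it. The budget is
    13/16 eps for the gap, and eps / 32 each for near-optimality, for mixing and for the estimation
    of f; the accuracy eps xi / (128 H) of the estimates is what this budget asks for. *)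

Section euclidean.
Context {R : realType} {T : finType}.
Implicit Types u v w : vec R T.

Lemma dotC u v : dot u v = dot v u.
Proof. by apply: eq_bigr => x _; rewrite mulrC. Qed.

Lemma dotDl u v w : dot (u + v) w = dot u w + dot v w.
Proof. by rewrite -big_split; apply: eq_bigr => x _; rewrite !ffunE mulrDl. Qed.

Lemma dotZl a u w : dot (a *: u) w = a * dot u w.
Proof. by rewrite /dot mulr_sumr; apply: eq_bigr => x _; rewrite !ffunE -mulrA. Qed.

Lemma dotNl u w : dot (- u) w = - dot u w.
Proof. by rewrite -scaleN1r dotZl mulN1r. Qed.

Lemma dotBl u v w : dot (u - v) w = dot u w - dot v w.
Proof. by rewrite dotDl dotNl. Qed.

Lemma dot0l w : dot 0 w = 0.
Proof. by rewrite -(scale0r w) dotZl mul0r. Qed.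

Lemma dot_suml (I : Type) (r : seq I) (P : pred I) (F : I -> vec R T) w :
  dot (\sum_(i <- r | P i) F i) w = \sum_(i <- r | P i) dot (F i) w.
Proof.
by elim/big_rec2: _ => [|i y1 y2 _ <-]; [exact: dot0l | rewrite dotDl].
Qed.

Lemma dotDr u v w : dot u (v + w) = dot u v + dot u w.
Proof. by rewrite dotC dotDl !(dotC u). Qed.

Lemma dotZr a u w : dot u (a *: w) = a * dot u w.
Proof. by rewrite dotC dotZl dotC. Qed.

Lemma dotNr u w : dot u (- w) = - dot u w.
Proof. by rewrite dotC dotNl dotC. Qed.

Lemma dotBr u v w : dot u (v - w) = dot u v - dot u w.
Proof. by rewrite dotDr dotNr. Qed.

Lemma dot_sumr (I : Type) (r : seq I) (P : pred I) (F : I -> vec R T) w :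
  dot w (\sum_(i <- r | P i) F i) = \sum_(i <- r | P i) dot w (F i).
Proof. by rewrite dotC dot_suml; apply: eq_bigr => i _; rewrite dotC. Qed.

Lemma dot_ge0 u : 0 <= dot u u.
Proof. by apply: sumr_ge0 => x _; rewrite -expr2 sqr_ge0. Qed.

Lemma dot_eq0 u : dot u u = 0 -> u = 0.
Proof.
move=> u0; apply/ffunP => x; rewrite ffunE; apply/eqP; rewrite -sqrf_eq0 expr2.
by have /psumr_eq0P := u0; move=> -> // y _; rewrite -expr2 sqr_ge0.
Qed.

Lemma cauchy_schwarz u v : (dot u v) ^+ 2 <= dot u u * dot v v.
Proof.
have [v0|v_gt0] := leP (dot v v) 0.
  rewrite (dot_eq0 (le_anti (_ : dot v v <= 0 <= dot v v))) ?v0 ?dot_ge0 //.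
  by rewrite (dotC u) !dot0l mulr0 expr0n.
have := dot_ge0 (dot v v *: u - dot u v *: v).
rewrite !(dotBl, dotBr, dotZl, dotZr) (dotC v u) => h.
rewrite -subr_ge0 -(pmulr_rge0 _ v_gt0); lra.
Qed.

Lemma enorm_ge0 u : 0 <= enorm u.
Proof. exact: sqrtr_ge0. Qed.

Lemma sqr_enorm u : enorm u ^+ 2 = dot u u.
Proof. by rewrite sqr_sqrtr ?dot_ge0. Qed.

Lemma dot_le_enorm u v : dot u v <= enorm u * enorm v.
Proof.
rewrite (le_trans (ler_norm _)) // -sqrtr_sqr -sqrtrM ?dot_ge0 //.
by rewrite ler_wsqrtr // cauchy_schwarz.
Qed.

Lemma enormD u v : enorm (u + v) <= enorm u + enorm v.
Proof.
rewrite -(@ler_pXn2r _ 2) ?nnegrE ?addr_ge0 ?enorm_ge0 // sqr_enorm sqrrD.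
rewrite !sqr_enorm !(dotDl, dotDr) (dotC v u).
have := dot_le_enorm u v; lra.
Qed.

Lemma enormZ a u : enorm (a *: u) = `|a| * enorm u.
Proof.
by rewrite /enorm dotZl dotZr mulrA -expr2 sqrtrM ?sqr_ge0 // sqrtr_sqr.
Qed.

Lemma enorm_sum (I : finType) (F : I -> vec R T) :
  enorm (\sum_i F i) <= \sum_i enorm (F i).
Proof.
elim/big_ind2: _ => [|x1 x2 y1 y2 h1 h2|//].
  by rewrite /enorm dot0l sqrtr0.
by rewrite (le_trans (enormD _ _)) ?lerD.
Qed.

Lemma enorm_le u v : (enorm u <= enorm v) = (dot u u <= dot v v).
Proof. by rewrite ler_sqrt ?dot_ge0. Qed.

Lemma sumr_norm_le_enorm u : \sum_x `|u x| <= Num.sqrt #|T|%:R * enorm u.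
Proof.
pose a : vec R T := [ffun x => `|u x|]; pose e : vec R T := [ffun=> 1].
have -> : \sum_x `|u x| = dot e a.
  by apply: eq_bigr => x _; rewrite !ffunE mul1r.
have <- : enorm e = Num.sqrt #|T|%:R.
  congr Num.sqrt; rewrite /dot (eq_bigr (fun=> 1)) ?sumr_const //.
  by move=> x _; rewrite ffunE mulr1.
have <- : enorm a = enorm u; last exact: dot_le_enorm.
congr Num.sqrt; apply: eq_bigr => x _.
by rewrite !ffunE -normrM ger0_norm // -expr2 sqr_ge0.
Qed.

End euclidean.

Section projection.
Context {R : realType} {T : finType}.
Implicit Types (u v y z : vec R T) (Y : set (vec R T)).

(** The variational inequality singles out the nearest point, so it determines the choice made by
    [eproj]. For the sets that occur, such a [y] is given by a formula. *)
Definition has_projections Y := forall v, exists2 y, Y y &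
  forall z, Y z -> dot (v - y) (z - y) <= 0.

Lemma eprojP Y (v : vec R T) : has_projections Y -> Y (eproj Y v) /\
  forall z, Y z ->
    dot (eproj Y v - z) (eproj Y v - z) <= dot (v - z) (v - z).
Proof.
move=> /(_ v)[y0 Yy0 vi].
(* For [z] in [Y] the middle term has a sign, so |v - z|^2 >= |v - y0|^2 + |z - y0|^2. This yields
   minimality and uniqueness of [y0], and also that projecting moves [v] no farther from [z]. *)
have pyth z : dot (v - z) (v - z) = dot (v - y0) (v - y0)
    - 2 * dot (v - y0) (z - y0) + dot (z - y0) (z - y0).
  rewrite !(dotBl, dotBr) (dotC y0 v) (dotC z v) (dotC z y0); lra.
have -> : eproj Y v = y0.
  rewrite /eproj; case: xgetP => [y _ [Yy ymin]|/(_ y0) []].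
    have := ymin _ Yy0; rewrite enorm_le pyth => h.
    apply/eqP; rewrite -subr_eq0; apply/eqP/dot_eq0.
    apply: le_anti; rewrite dot_ge0 andbT.
    have := vi _ Yy; lra.
  split=> // z Yz; rewrite enorm_le (pyth z).
  by have := vi _ Yz; have := dot_ge0 (z - y0); lra.
split=> // z Yz; rewrite (pyth z).
have -> : dot (y0 - z) (y0 - z) = dot (z - y0) (z - y0).
  by rewrite -opprB dotNl dotNr opprK.
by have := vi _ Yz; have := dot_ge0 (v - y0); lra.
Qed.

Arguments eprojP {Y} v.

Lemma unit_box_has_projections :
  has_projections [set r : vec R T | forall x, 0 <= r x <= 1].
Proof.
move=> v; exists [ffun x => Num.min 1 (Num.max 0 (v x))].
  by move=> x; rewrite ffunE le_min ler01 le_max lexx ge_min lexx.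
move=> z zb; apply: sumr_le0 => x _; rewrite !ffunE.
have /andP[z0 z1] := zb x.
rewrite -oppr_ge0 -mulNr.
case: (leP 0 (v x)) => v0; last by rewrite min_r ?ler01 // mulr_ge0 //; lra.
case: (leP 1 (v x)) => v1; last by rewrite subrr oppr0 mul0r.
by rewrite -mulrNN mulr_ge0 //; lra.
Qed.

(** Take positive parts, then shrink radially into the ball. The residual [v - p] is orthogonal to
    [p] and has nonpositive product with every point of the orthant, so the second projection does
    not disturb the first. *)
Lemma orthant_ball_has_projections s :
  0 <= s -> has_projections [set l : vec R T |
    (forall c, 0 <= l c) /\ enorm l <= s].
Proof.
move=> s0 v; pose p : vec R T := [ffun x => Num.max 0 (v x)].
have p0 x : 0 <= p x by rewrite ffunE le_max lexx.
pose a := if enorm p <= s then 1 else s / enorm p.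
have ap : 0 <= a /\ enorm (a *: p) <= s /\
    forall z, enorm z <= s -> (1 - a) * (dot p z - a * dot p p) <= 0.
  rewrite /a; case: (leP (enorm p) s) => h.
    by rewrite scale1r; split=> //; split=> // z _; lra.
  have hp : 0 < enorm p by rewrite (le_lt_trans s0).
  split; first by rewrite divr_ge0 // ltW.
  split; first by rewrite enormZ ger0_norm ?divr_ge0 ?(ltW hp) // divfK ?gt_eqF.
  move=> z zs; rewrite mulr_ge0_le0 //.
    by rewrite subr_ge0 ler_pdivrMr // mul1r ltW.
  rewrite subr_le0 -sqr_enorm expr2 mulrA divfK ?gt_eqF //.
  by rewrite (le_trans (dot_le_enorm _ _)) // mulrC ler_wpM2r // ltW.
case: ap => a0 [aps av]; exists (a *: p).
  by split=> // c; rewrite ffunE mulr_ge0.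
move=> z [z0 zs].
have -> : dot (v - a *: p) (z - a *: p) =
    dot (v - p) z - a * dot (v - p) p + (1 - a) * (dot p z - a * dot p p).
  rewrite !(dotBl, dotBr, dotZl, dotZr); ring.
have -> : dot (v - p) p = 0.
  apply: big1 => x _; rewrite !ffunE; case: leP => _; first by rewrite subrr mul0r.
  by rewrite mulr0.
rewrite mulr0 subr0 -[leRHS]addr0 lerD ?av //.
apply: sumr_le0 => x _; rewrite mulr_le0_ge0 // !ffunE subr_le0.
by rewrite le_max lexx orbT.
Qed.

Lemma multipliers_has_projections b s :
  0 <= s -> has_projections (@multipliers R T b s).
Proof.
move=> s0; case: b; first exact: orthant_ball_has_projections.
move=> v; have [y [y0 ys] vi] := orthant_ball_has_projections s0 (- v).
have enormN u : enorm (- u) = enorm u by rewrite -scaleN1r enormZ normrN1 mul1r.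
exists (- y); first by split=> [c|]; rewrite ?enormN // ffunE oppr_le0.
move=> z [z0 zs]; have := vi (- z); rewrite !(dotBl, dotBr, dotNl, dotNr).
have : (forall c, 0 <= (- z) c) /\ enorm (- z) <= s.
  by split=> [c|]; rewrite ?enormN // ffunE oppr_ge0.
move=> hz /(_ hz); lra.
Qed.

End projection.

(** * Primal-dual subgradient method *)

Section primal_dual.
Context {R : realType} {X T : finType}.
Variables (b : bool) (alpha s B : R) (c : vec R X).
Variables (g : vec R X -> vec R T) (G : vec R X -> T -> vec R X).

Let box := [set r : vec R X | forall x, 0 <= r x <= 1].
Let sg : R := if b then 1 else -1.
Let a : R := if b then - alpha else alpha.
Let m : R := #|T|%:R.

Hypotheses (s_ge0 : 0 <= s) (alpha_gt0 : 0 < alpha).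
Hypothesis c_le : dot c c <= B.
Hypothesis G_le : forall r t, box r -> dot (G r t) (G r t) <= B.
Hypothesis g_le : forall r t, box r -> `|g r t| <= B.
Hypothesis subgradient : forall r z t, box r -> box z ->
  g r t + dot (G r t) (z - r) <= g z t.

Definition primal_dual_step (rl : vec R X * vec R T) : vec R X * vec R T :=
  (eproj box (rl.1 + a *: (c + \sum_t rl.2 t *: G rl.1 t)),
   eproj (@multipliers R T b s) (rl.2 - a *: g rl.1)).

Let it k := iter k primal_dual_step (0, 0).

Definition primal_mean K : vec R X := K%:R^-1 *: \sum_(k < K) (it k).1.

Let B_ge0 : 0 <= B. Proof. exact: le_trans (dot_ge0 c) c_le. Qed.

Let itP k : box (it k).1 /\ multipliers b s (it k).2.
Proof.
elim: k => [|k [IH1 IH2]] /=.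
  split=> [x|]; first by rewrite ffunE lexx ler01.
  split=> [x|]; first by rewrite ffunE; case: b.
  by rewrite /enorm dot0l sqrtr0.
split; first exact: (proj1 (eprojP _ (@unit_box_has_projections R X))).
exact: (proj1 (eprojP _ (multipliers_has_projections b s_ge0))).
Qed.

Let grad_le r (l : vec R T) : box r -> enorm l <= s ->
  dot (c + \sum_t l t *: G r t) (c + \sum_t l t *: G r t) <=
  B * (1 + s * Num.sqrt m) ^+ 2.
Proof.
move=> br ls; set u := c + _.
have GB t : enorm (G r t) <= Num.sqrt B by rewrite ler_wsqrtr ?G_le.
have : enorm u <= Num.sqrt B * (1 + s * Num.sqrt m).
  rewrite (le_trans (enormD _ _)) // mulrDr mulr1 lerD ?ler_wsqrtr //.
  rewrite (le_trans (enorm_sum _)) //.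
  apply: (@le_trans _ _ (\sum_t `|l t| * Num.sqrt B)).
    by apply: ler_sum => t _; rewrite enormZ ler_wpM2l.
  rewrite -mulr_suml mulrC ler_wpM2l ?sqrtr_ge0 //.
  rewrite (le_trans (sumr_norm_le_enorm _)) // mulrC ler_wpM2r ?sqrtr_ge0 //.
have e0 : 0 <= 1 + s * Num.sqrt m by rewrite addr_ge0 ?mulr_ge0 ?sqrtr_ge0.
move=> h; rewrite -sqr_enorm -[in leRHS](sqr_sqrtr B_ge0) -exprMn.
by rewrite ler_pXn2r ?nnegrE ?enorm_ge0 ?mulr_ge0 ?sqrtr_ge0.
Qed.

Let constr_le r : box r -> dot (g r) (g r) <= m * B ^+ 2.
Proof.
move=> br; rewrite /m -sumr_const mulr_suml.
apply: ler_sum => t _.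
by rewrite mul1r -expr2 -[leLHS]real_normK ?num_real // ler_pXn2r ?nnegrE ?g_le.
Qed.

(** Bounds the squared lengths of the two gradients together. [B] bounds squared norms in the primal
    part and absolute values in the dual part; both bounds will be 2H. *)
Let W := B * (1 + s * Num.sqrt m) ^+ 2 + m * B ^+ 2.

Let energy (z : vec R X) (nu : vec R T) k :=
  dot ((it k).1 - z) ((it k).1 - z) + dot ((it k).2 - nu) ((it k).2 - nu).

Let step_le z nu k : box z -> multipliers b s nu -> (forall t, g z t <= 0) ->
  2 * alpha * (sg * dot c ((it k).1 - z) + sg * dot nu (g (it k).1)) <=
  energy z nu k - energy z nu k.+1 + alpha ^+ 2 * W.
Proof.
move=> bz mnu gz; have [br ml] := itP k.
rewrite /energy /it iterS -/(it k).
case: (it k) br ml => r l /= br ml.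
set u := c + \sum_t l t *: G r t.
have [_ /(_ z bz) h1] := eprojP (r + a *: u) (@unit_box_has_projections R X).
have [_ /(_ nu mnu) h2] := eprojP (l - a *: g r)
  (@multipliers_has_projections R T b _ s_ge0).
have u_le : dot u u <= B * (1 + s * Num.sqrt m) ^+ 2 by apply: grad_le; case: ml.
have g_le' := constr_le br.
have a2 : a ^+ 2 = alpha ^+ 2 by rewrite /a; case: (b); rewrite ?sqrrN.
have asg : a = - (sg * alpha).
  by rewrite /a /sg; case: (b); rewrite ?mul1r ?mulN1r ?opprK.
have {}h1 : dot (eproj box (r + a *: u) - z) (eproj box (r + a *: u) - z) <=
    dot (r - z) (r - z) + 2 * a * dot u (r - z) + a ^+ 2 * dot u u.
  apply: le_trans h1 _; rewrite addrAC; move: (r - z) (u) => p u'.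
  by rewrite !(dotDl, dotDr, dotZl, dotZr) (dotC p u'); lra.
have {}h2 : dot (eproj (@multipliers R T b s) (l - a *: g r) - nu)
      (eproj (@multipliers R T b s) (l - a *: g r) - nu) <=
    dot (l - nu) (l - nu) - 2 * a * dot (g r) (l - nu) + a ^+ 2 * dot (g r) (g r).
  apply: le_trans h2 _; rewrite addrAC; move: (l - nu) => p.
  by rewrite !(dotBl, dotBr, dotZl, dotZr) (dotC p (g r)); lra.
(* The terms in [l] drop out with the right sign: [sg * l t] is nonnegative, and the subgradient
   inequality with [g z t <= 0] gives [dot (G r t) (r - z) >= g r t]. *)
have key : sg * dot c (r - z) + sg * dot nu (g r) <=
    sg * (dot u (r - z) - dot (g r) (l - nu)).
  rewrite /u dotDl (dotBr (g r)) (dotC (g r) nu) dot_suml.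
  suff : 0 <= sg * (\sum_t dot (l t *: G r t) (r - z) - dot (g r) l) by lra.
  rewrite /dot -sumrB mulr_sumr; apply: sumr_ge0 => t _.
  rewrite -/(dot _ _) dotZl (mulrC (g r t)) -mulrBr mulrA.
  rewrite mulr_ge0 //.
    by case: ml => /(_ t) + _; rewrite /sg; case: (b); lra.
  have := subgradient t br bz; rewrite -opprB dotNr; have := gz t; lra.
have : alpha ^+ 2 * (dot u u + dot (g r) (g r)) <= alpha ^+ 2 * W.
  by rewrite ler_wpM2l ?sqr_ge0 // lerD.
have := ler_wpM2l (ltW alpha_gt0) key.
move: h1 h2; rewrite a2 asg.
move: (dot (eproj box _ - z) _) (dot (eproj _ _ - nu) _) (dot u u) => E1 E2 uu.
move: (dot u _) (dot (g r) (l - nu)) (dot (g r) _) (dot (r - z) _) => x1 x2 x3 x4.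
move: (dot (l - nu) _) (dot c _) (dot nu _) => x5 x6 x7.
lra.
Qed.

Lemma box_scaled_sum K (r : nat -> vec R X) : (0 < K)%N ->
  (forall k, box (r k)) -> box (K%:R^-1 *: \sum_(k < K) r k).
Proof.
move=> K0 br x; rewrite ffunE sum_ffunE /GRing.scale /=.
have K0' : 0 < K%:R :> R by rewrite ltr0n.
apply/andP; split.
  apply: mulr_ge0; first by rewrite invr_ge0 ltW.
  by apply: sumr_ge0 => k _; case/andP: (br k x).
rewrite mulrC ler_pdivrMr // mul1r -[X in _ <= X%:R](card_ord K) -sumr_const.
by apply: ler_sum => k _; case/andP: (br k x).
Qed.

Lemma primal_mean_box K : (0 < K)%N -> box (primal_mean K).
Proof.
move=> K0.
exact: (@box_scaled_sum _ (fun k => (it k).1) K0 (fun k => (itP k).1)).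
Qed.

Lemma primal_dual_gap K z nu : (0 < K)%N ->
  box z -> multipliers b s nu -> (forall t, g z t <= 0) ->
  sg * dot c (primal_mean K - z) + sg * dot nu (g (primal_mean K)) <=
  (dot z z + dot nu nu) / (2 * alpha * K%:R)
  + alpha / 2 * (B * (1 + s * Num.sqrt m) ^+ 2 + m * B ^+ 2).
Proof.
move=> K0 bz mnu gz; rewrite -/W.
have K0' : 0 < K%:R :> R by rewrite ltr0n.
have br := primal_mean_box K0; set rb := primal_mean K in br *.
have rbE : K%:R *: rb = \sum_(k < K) (it k).1.
  by rewrite /rb /primal_mean scalerA divff ?scale1r ?gt_eqF.
(* Jensen's inequality: the linear terms of the subgradient inequalities at the mean [rb] sum to
   zero. *)
have convex t : K%:R * g rb t <= \sum_(k < K) g (it k).1 t.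
  apply: (@le_trans _ _ (\sum_(k < K) (g rb t + dot (G rb t) ((it k).1 - rb)))).
    rewrite big_split /= sumr_const card_ord mulr_natl lerDl -dot_sumr sumrB.
    by rewrite -rbE sumr_const card_ord scaler_nat subrr dotC dot0l.
  by apply: ler_sum => k _; apply: subgradient => //; case: (itP k).
have lin : K%:R * (sg * dot c (rb - z) + sg * dot nu (g rb)) <=
    \sum_(k < K) (sg * dot c ((it k).1 - z) + sg * dot nu (g (it k).1)).
  rewrite big_split /= mulrDr lerD //.
    rewrite -mulr_sumr mulrCA -dotZr scalerBr rbE -dot_sumr sumrB.
    by rewrite sumr_const card_ord scaler_nat.
  have -> : K%:R * (sg * dot nu (g rb)) = \sum_t sg * nu t * (K%:R * g rb t).
    rewrite mulrA mulr_sumr; apply: eq_bigr => t _; ring.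
  have -> : \sum_(k < K) sg * dot nu (g (it k).1) =
      \sum_t sg * nu t * \sum_(k < K) g (it k).1 t.
    under eq_bigr do rewrite mulr_sumr.
    rewrite exchange_big; apply: eq_bigr => t _; rewrite mulr_sumr.
    by apply: eq_bigr => k _; rewrite mulrA.
  apply: ler_sum => t _; rewrite ler_wpM2l //.
  by case: mnu => /(_ t) + _; rewrite /sg; case: (b); lra.
(* Both iterates start at 0, so the right-hand side is the initial energy; the final one is
   dropped. *)
have tele : \sum_(k < K) (energy z nu k - energy z nu k.+1) <= dot z z + dot nu nu.
  rewrite -(big_mkord xpredT (fun k => energy z nu k - energy z nu k.+1)).
  under eq_bigr do rewrite -opprB.
  rewrite sumrN telescope_sumr // opprB {1}/energy /= !sub0r !dotNl !dotNr.
  by rewrite !opprK gerBl addr_ge0 ?dot_ge0.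
have total : 2 * alpha * K%:R * (sg * dot c (rb - z) + sg * dot nu (g rb)) <=
    dot z z + dot nu nu + K%:R * (alpha ^+ 2 * W).
  have a2 : 0 <= 2 * alpha by rewrite mulr_ge0 // ltW.
  rewrite -mulrA (le_trans (ler_wpM2l a2 lin)) //.
  apply: (@le_trans _ _ (\sum_(k < K)
      (energy z nu k - energy z nu k.+1 + alpha ^+ 2 * W))).
    by rewrite mulr_sumr; apply: ler_sum => k _; exact: step_le.
  by rewrite big_split /= sumr_const card_ord mulr_natl lerD2r.
have -> : alpha / 2 * W = K%:R * (alpha ^+ 2 * W) / (2 * alpha * K%:R).
  by field; rewrite !gt_eqF.
by rewrite -mulrDl ler_pdivlMr ?mulr_gt0 // mulrC.
Qed.

End primal_dual.

(** * Optimal value from the gap inequality, with perturbed objective and constraints *)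

Section saddle_value.
Context {R : realType} {X T : finType}.
Variables (b : bool) (alpha s B : R) (c c0 : vec R X).
Variables (g g0 : vec R X -> vec R T) (G : vec R X -> T -> vec R X).
Variables (eps xi eta D v : R) (rs : vec R X) (K : nat).

Let box := [set r : vec R X | forall x, 0 <= r x <= 1].
Let sg : R := if b then 1 else -1.
Let m : R := #|T|%:R.

Lemma box_dot_le (r : vec R X) : box r -> dot r r <= #|X|%:R.
Proof.
move=> br; rewrite -[leRHS]mulr1 mulr_natl -sumr_const.
by apply: ler_sum => x _; have /andP[? ?] := br x; rewrite mulr_ile1.
Qed.

Lemma box_convex (r z : vec R X) th : 0 <= th <= 1 -> box r -> box z ->
  box ((1 - th) *: r + th *: z).
Proof.
move=> th01 br bz x; rewrite !ffunE /GRing.scale /=.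
by have := br x; have := bz x; nra.
Qed.

Hypotheses (K_gt0 : (0 < K)%N) (s_gt0 : 0 < s) (alpha_gt0 : 0 < alpha).
Hypothesis c_le : dot c c <= B.
Hypothesis G_le : forall r t, box r -> dot (G r t) (G r t) <= B.
Hypothesis g_le : forall r t, box r -> `|g r t| <= B.
Hypothesis subgradient : forall r z t, box r -> box z ->
  g r t + dot (G r t) (z - r) <= g z t.

Hypotheses (eps_gt0 : 0 < eps) (xi_gt0 : 0 < xi).
Hypotheses (D_ge0 : 0 <= D) (eta_ge0 : 0 <= eta) (eta_le : eta <= xi).
Hypothesis Deta : D * eta <= xi * (eps / 32).
Hypothesis sxi : 4 * D <= s * xi.
Hypothesis gap_le : (#|X|%:R + s ^+ 2) / (2 * alpha * K%:R)
  + alpha / 2 * (B * (1 + s * Num.sqrt m) ^+ 2 + m * B ^+ 2) <= 13 / 16 * eps.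

Hypothesis c_close : forall r, box r -> `|dot c r - dot c0 r| <= eps / 32.
Hypothesis g_close : forall r t, box r -> `|g r t - g0 r t| <= eta.
Hypothesis g0_convex : forall r z (th : R) t, box r -> box z -> 0 <= th <= 1 ->
  g0 ((1 - th) *: r + th *: z) t <= (1 - th) * g0 r t + th * g0 z t.
Hypothesis c0_range : forall r z, box r -> box z -> `|dot c0 r - dot c0 z| <= D.
Hypotheses (rs_box : box rs) (rs_slater : forall t, g0 rs t <= - xi).

(* [v] is, up to a negligible slack, the optimal value of the exact problem. *)
Hypothesis v_lb : forall z, box z -> (forall t, g0 z t <= 0) -> v <= sg * dot c0 z.
Hypothesis v_approx : exists2 z, box z &
  (forall t, g0 z t <= 0) /\ sg * dot c0 z <= v + eps / 32.

Let sg_norm x : `|sg * x| = `|x|.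
Proof. by rewrite normrM /sg; case: (b); rewrite ?normrN1 ?normr1 mul1r. Qed.

(* Mixing with the Slater point repairs a constraint violation [e] at the cost
   [D * e / xi]. *)
Let repair (e : R) (r : vec R X) : 0 <= e -> box r -> (forall t, g0 r t <= e) ->
  exists2 z, box z & (forall t, g0 z t <= 0) /\
    sg * dot c0 z <= sg * dot c0 r + D * e / xi.
Proof.
move=> e0 br gr; have ex : 0 < e + xi by rewrite ltr_wpDl.
(* At this weight violation and slack cancel: [(xi * e - e * xi) / (e + xi)] is 0. *)
have th01 : 0 <= e / (e + xi) <= 1.
  by rewrite divr_ge0 ?(ltW ex) //= ler_pdivrMr // mul1r lerDl ltW.
exists ((1 - e / (e + xi)) *: r + (e / (e + xi)) *: rs).
  exact: box_convex.
split=> [t|].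
  apply: le_trans (g0_convex _ br rs_box th01) _.
  have := gr t; have := rs_slater t; set x := g0 rs t; set y := g0 r t => hx hy.
  have -> : 1 - e / (e + xi) = xi / (e + xi) by field; rewrite gt_eqF.
  have -> : xi / (e + xi) * y + e / (e + xi) * x = (xi * y + e * x) / (e + xi).
    by field; rewrite gt_eqF.
  rewrite pmulr_lle0 ?invr_gt0 //.
  have := ler_wpM2l (ltW xi_gt0) hy; have := ler_wpM2l e0 hx; lra.
rewrite dotDr !dotZr.
have : sg * (dot c0 rs - dot c0 r) <= D.
  by rewrite (le_trans (ler_norm _)) // sg_norm c0_range.
have : e / (e + xi) <= e / xi.
  by rewrite ler_wpM2l // lef_pV2 ?posrE // lerDr.
have /andP[] := th01; move: (e / (e + xi)) => th th0 _ h1 h2.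
have := ler_wpM2l th0 h2; have := ler_wpM2l D_ge0 h1.
rewrite mulrA; lra.
Qed.

(** The comparison point of the gap inequality has to satisfy the estimated constraints. Mixing with
    weight [eta / xi] creates a margin [eta] in the exact constraints, which covers the estimation
    error. *)
Let repair_approx (r : vec R X) : box r -> (forall t, g0 r t <= 0) ->
  exists2 z, box z & (forall t, g z t <= 0) /\
    sg * dot c0 z <= sg * dot c0 r + D * eta / xi.
Proof.
move=> br gr.
have th01 : 0 <= eta / xi <= 1.
  by rewrite divr_ge0 ?(ltW xi_gt0) //= ler_pdivrMr // mul1r.
exists ((1 - eta / xi) *: r + (eta / xi) *: rs); first exact: box_convex.
split=> [t|].
  have := g_close t (box_convex th01 br rs_box); rewrite ler_norml => /andP[_].
  have := g0_convex t br rs_box th01.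
  have := gr t; have := rs_slater t.
  have := divfK (lt0r_neq0 xi_gt0) eta; nra.
rewrite dotDr !dotZr.
have : sg * (dot c0 rs - dot c0 r) <= D.
  by rewrite (le_trans (ler_norm _)) // sg_norm c0_range.
have /andP[] := th01; rewrite -mulrA; move: (eta / xi) => th th0 _ h2.
have := ler_wpM2l th0 h2; lra.
Qed.

Lemma primal_dual_value :
  `|sg * dot c (primal_mean b alpha s c g G K) - v| <= eps.
Proof.
have s_ge0 := ltW s_gt0.
have br := primal_mean_box b alpha c g G s_ge0 K_gt0.
have gap z nu := @primal_dual_gap _ _ _ b _ _ _ _ _ _ s_ge0 alpha_gt0
  c_le G_le g_le subgradient K z nu K_gt0.
set rb := primal_mean _ _ _ _ _ _ _ in br gap *.
have [z0 bz0 [gz0 z0v]] := v_approx.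
have [z bz [gz zz0]] := repair_approx bz0 gz0.
pose Gam := 13 / 16 * eps.
have aK : 0 < 2 * alpha * K%:R by rewrite !mulr_gt0 ?ltr0n.
have gapG nu : multipliers b s nu ->
    sg * dot c (rb - z) + sg * dot nu (g rb) <= Gam.
  move=> mnu; apply: le_trans (gap z nu bz mnu gz) _.
  apply: le_trans gap_le; rewrite lerD2r ler_pM2r ?invr_gt0 //.
  by rewrite lerD ?box_dot_le // -sqr_enorm ler_pXn2r ?nnegrE ?enorm_ge0 //; case: mnu.
have gap0 : sg * dot c (rb - z) <= Gam.
  have := gapG 0; rewrite dot0l mulr0 addr0; apply; split=> [t|].
    by rewrite ffunE; case: (b).
  by rewrite /enorm dot0l sqrtr0.
have gapt t : sg * dot c (rb - z) + s * g rb t <= Gam.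
  pose e : vec R T := [ffun t' => (t' == t)%:R * (sg * s)].
  have de (u : vec R T) : dot e u = sg * s * u t.
    rewrite /dot (bigD1 t) //= big1 ?addr0 => [|t' /negbTE nt].
      by rewrite ffunE eqxx mul1r.
    by rewrite ffunE nt !mul0r.
  have sg2 : sg * sg = 1 by rewrite /sg; case: (b); rewrite ?mulr1 ?mulrNN ?mulr1.
  have := gapG e; rewrite de !mulrA sg2 mul1r; apply; split=> [t'|].
    rewrite ffunE /sg; case: (t' == t); case: (b); rewrite /= ?mul0r //;
    by rewrite ?mul1r ?mulN1r ?oppr_le0.
  rewrite /enorm de ffunE eqxx mul1r mulrACA sg2 mul1r -expr2 sqrtr_sqr.
  by rewrite ger0_norm.
have sgc r : box r -> `|sg * dot c r - sg * dot c0 r| <= eps / 32.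
  by move=> /c_close; rewrite -mulrBr sg_norm.
have czz : sg * dot c z <= v + 3 / 32 * eps.
  have := sgc z bz; rewrite ler_norml => /andP[_ h].
  have : D * eta / xi <= eps / 32 by rewrite ler_pdivrMr // [leRHS]mulrC.
  lra.
pose rho := (Gam - sg * dot c (rb - z)) / s.
have rho0 : 0 <= rho by rewrite divr_ge0 // subr_ge0.
have grho t : g0 rb t <= rho + eta.
  have := g_close t br; rewrite ler_norml => /andP[h _].
  suff : g rb t <= rho by lra.
  by rewrite /rho ler_pdivlMr // lerBrDl (mulrC _ s) gapt.
have [z' bz' [gz' z'v]] := repair (addr_ge0 rho0 eta_ge0) br grho.
have := v_lb bz' gz'; have := sgc rb br; rewrite ler_norml => /andP[h1 h2].
(* The quarter comes from [4 * D <= s * xi]. Moving it to the other side leaves an error of 37/96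
   eps below [v]; the error above [v] is at most 29/32 eps. *)
have : D * (rho + eta) / xi <= (Gam - sg * dot c (rb - z)) / 4 + eps / 32.
  rewrite ler_pdivrMr //.
  have := ler_wpM2l rho0 sxi.
  have -> : rho * (s * xi) = (Gam - sg * dot c (rb - z)) * xi.
    by rewrite mulrA /rho divfK ?gt_eqF.
  by move: (dot c (rb - z)) Deta => q; lra.
rewrite dotBr mulrBr in gap0 *; rewrite /Gam in gap0 *.
rewrite ler_norml; move: czz gap0 z'v; lra.
Qed.

End saddle_value.

(** * Finite probability *)

Section finite_probability.
Context {R : realType}.

Lemma prE (T : finType) (mu : T -> R) (E : T -> Prop) :
  pr mu E = \sum_w mu w * `[< E w >]%:R.
Proof.
by rewrite /pr big_mkcond; apply: eq_bigr => w _; case: asboolP; rewrite ?mulr1 ?mulr0.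
Qed.

Lemma pr_complement (T : finType) (mu : T -> R) (E : T -> Prop) :
  \sum_w mu w = 1 -> pr mu E = 1 - pr mu (fun w => ~ E w).
Proof.
move=> <-; rewrite !prE -sumrB; apply: eq_bigr => w _.
by rewrite asbool_neg; case: asboolP => _ /=; lra.
Qed.

Lemma pr_le (T : finType) (mu : T -> R) (E F : T -> Prop) :
  (forall w, 0 <= mu w) -> (forall w, E w -> F w) -> pr mu E <= pr mu F.
Proof.
move=> mu0 EF; rewrite !prE; apply: ler_sum => w _; rewrite ler_wpM2l //.
by case: asboolP => // /EF /asboolP ->.
Qed.

Lemma union_bound (T I : finType) (mu : T -> R) (E : I -> T -> Prop) :
  (forall w, 0 <= mu w) ->
  pr mu (fun w => exists i, E i w) <= \sum_i pr mu (E i).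
Proof.
move=> mu0; under eq_bigr do rewrite prE.
rewrite prE exchange_big; apply: ler_sum => w _; rewrite -mulr_sumr ler_wpM2l //=.
have ind0 j : 0 <= `[< E j w >]%:R :> R by rewrite ler0n.
case: asboolP => [[i /asboolP Ei]|_]; last exact: sumr_ge0.
by rewrite (bigD1 i) //= Ei lerDl sumr_ge0.
Qed.

Lemma union_bound2 (T : finType) (mu : T -> R) (E F : T -> Prop) :
  (forall w, 0 <= mu w) -> pr mu (fun w => E w \/ F w) <= pr mu E + pr mu F.
Proof.
move=> mu0; rewrite !prE -big_split /=; apply: ler_sum => w _.
rewrite -mulrDr ler_wpM2l // -natrD ler_nat asbool_or.
by case: asboolP; case: asboolP.
Qed.

Lemma pr_fst (T1 T2 : finType) (mu1 : T1 -> R) (mu2 : T2 -> R) (E : T1 -> Prop) :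
  \sum_w mu2 w = 1 ->
  pr (fun w : T1 * T2 => mu1 w.1 * mu2 w.2) (fun w => E w.1) = pr mu1 E.
Proof.
move=> mu2_1; rewrite !prE -(pair_bigA _ (fun x y => mu1 x * mu2 y * `[< E x >]%:R)).
apply: eq_bigr => x _; under eq_bigr do rewrite mulrAC.
by rewrite -mulr_sumr mu2_1 mulr1.
Qed.

Lemma pr_snd (T1 T2 : finType) (mu1 : T1 -> R) (mu2 : T2 -> R) (E : T2 -> Prop) :
  \sum_w mu1 w = 1 ->
  pr (fun w : T1 * T2 => mu1 w.1 * mu2 w.2) (fun w => E w.2) = pr mu2 E.
Proof.
move=> mu1_1; rewrite !prE -(pair_bigA _ (fun x y => mu1 x * mu2 y * `[< E y >]%:R)).
rewrite exchange_big; apply: eq_bigr => y _; under eq_bigr do rewrite -mulrA.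
by rewrite -mulr_suml mu1_1 mul1r.
Qed.

Section product.
Context {I T : finType}.
Variable mu : I -> T -> R.
Hypotheses (mu_ge0 : forall i x, 0 <= mu i x) (mu_sum1 : forall i, \sum_x mu i x = 1).

Definition product_pr (w : {ffun I -> T}) : R := \prod_i mu i (w i).

Lemma product_pr_ge0 w : 0 <= product_pr w.
Proof. exact: prodr_ge0. Qed.

Lemma product_expectation (F : I -> T -> R) :
  \sum_w product_pr w * \prod_i F i (w i) = \prod_i \sum_x mu i x * F i x.
Proof. by rewrite bigA_distr_bigA; apply: eq_bigr => w _; rewrite -big_split. Qed.

Lemma product_pr_sum1 : \sum_w product_pr w = 1.
Proof. by rewrite /product_pr -bigA_distr_bigA big1. Qed.

Lemma pr_marginal i (E : T -> Prop) :
  pr product_pr (fun w => E (w i)) = pr (mu i) E.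
Proof.
pose F j x : R := if j == i then `[< E x >]%:R else 1.
transitivity (\sum_w product_pr w * \prod_j F j (w j)).
  rewrite prE; apply: eq_bigr => w _; congr (_ * _).
  by rewrite (bigD1 i) //= {1}/F eqxx big1 ?mulr1 // => j /negbTE; rewrite /F => ->.
rewrite product_expectation (bigD1 i) //= [X in _ * X]big1 ?mulr1.
  by rewrite prE; apply: eq_bigr => x _; rewrite /F eqxx.
move=> j /negbTE ji; rewrite -[RHS](mu_sum1 j).
by apply: eq_bigr => x _; rewrite /F ji mulr1.
Qed.

End product.

(** [1 - x <= expR (- x)] gives the bound [(1 - x)^-1]; multiplied out, the comparison with the
    quadratic is [0 <= x ^+ 2 * (1 - 2 * x)]. No lower bound on [x] enters. *)
Lemma expR_le_quadratic (x : R) : x <= 1 / 2 -> expR x <= 1 + x + 2 * x ^+ 2.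
Proof.
move=> x2; have x1 : 0 < 1 - x by lra.
have : expR x <= (1 - x)^-1.
  by rewrite -[expR x]invrK -expRN lef_pV2 ?posrE ?expR_gt0 // expR_ge1Dx.
move/le_trans; apply; rewrite -[leLHS]mul1r ler_pdivrMr //.
have : 0 <= x ^+ 2 * (1 - 2 * x) by rewrite mulr_ge0 ?sqr_ge0 //; lra.
nra.
Qed.

Lemma mgf_le (T : finType) (mu : T -> R) (Y : T -> R) (l : R) :
  (forall x, 0 <= mu x) -> \sum_x mu x = 1 -> \sum_x mu x * Y x = 0 ->
  (forall x, `|Y x| <= 1) -> 0 <= l <= 1 / 2 ->
  \sum_x mu x * expR (l * Y x) <= expR (2 * l ^+ 2).
Proof.
move=> mu0 mu1 EY Y1 /andP[l0 l2].
rewrite (le_trans _ (expR_ge1Dx _)) //.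
have -> : 1 + 2 * l ^+ 2 = \sum_x mu x * (1 + l * Y x + 2 * l ^+ 2).
  under eq_bigr do rewrite mulrDr mulrDr mulr1 mulrCA.
  by rewrite !big_split /= -mulr_sumr EY mulr0 addr0 -mulr_suml mu1 mul1r.
apply: ler_sum => x _; rewrite ler_wpM2l //.
have := Y1 x; rewrite ler_norml => /andP[h1 h2].
have h3 : (l * Y x) ^+ 2 <= l ^+ 2.
  by rewrite exprMn ler_piMr ?sqr_ge0 // -real_normK ?num_real // expr_le1.
have : l * Y x <= 1 / 2 by nra.
move/expR_le_quadratic => h; apply: (le_trans h); lra.
Qed.

(* Exponential Markov inequality with exponent [t / 4]. *)
Lemma hoeffding_bound (I T : finType) (mu : I -> T -> R) (Y : T -> R) (P : pred I)
    (t : R) :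
  (forall i x, 0 <= mu i x) -> (forall i, \sum_x mu i x = 1) ->
  (forall i, P i -> \sum_x mu i x * Y x = 0) ->
  (forall x, `|Y x| <= 1) -> 0 <= t <= 2 ->
  pr (product_pr mu) (fun w => #|P|%:R * t < \sum_(i | P i) Y (w i))
  <= expR (- (#|P|%:R * t ^+ 2 / 8)).
Proof.
move=> mu0 mu1 EY Y1 /andP[t0 t2]; pose l := t / 4.
(* The product measure carries all datasets at once; coordinates outside [P] integrate to 1. On [P]
   the exponent per coordinate is [2 * l ^+ 2 - l * t], which is [- t ^+ 2 / 8] at [l = t / 4]. *)
pose F i x : R := if P i then expR (l * Y x) else 1.
have l01 : 0 <= l <= 1 / 2 by rewrite /l; lra.
have l0 : 0 <= l by case/andP: l01.
apply: (@le_trans _ _ (expR (- (l * (#|P|%:R * t))) *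
    \sum_w product_pr mu w * \prod_i F i (w i))).
  rewrite prE mulr_sumr; apply: ler_sum => w _.
  rewrite mulrCA ler_wpM2l ?product_pr_ge0 //.
  have -> : \prod_i F i (w i) = expR (l * \sum_(i | P i) Y (w i)).
    by rewrite mulr_sumr expR_sum [RHS]big_mkcond.
  rewrite -expRD; case: asboolP => [h|_]; last exact: expR_ge0.
  rewrite (le_trans _ (expR_ge1Dx _)) // lerDl addrC subr_ge0 ler_wpM2l //.
  exact: ltW.
rewrite product_expectation.
have : \prod_i \sum_x mu i x * F i x <= \prod_(i | P i) expR (2 * l ^+ 2).
  rewrite [leRHS]big_mkcond; apply: ler_prod => i _.
  rewrite /F; case: (boolP (P i)) => Pi; apply/andP; split.
  - by apply: sumr_ge0 => x _; rewrite mulr_ge0 ?expR_ge0.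
  - by apply: mgf_le => //; exact: EY.
  - by apply: sumr_ge0 => x _; rewrite mulr1.
  - by under eq_bigr do rewrite mulr1; rewrite mu1.
rewrite prodr_const -expRM_natl => h.
apply: (le_trans (ler_wpM2l (expR_ge0 _) h)).
by rewrite -expRD ler_expR /l; lra.
Qed.

(** Exploration is adaptive, so its law is not a product measure. Splitting off the first entry [x]
    leaves a chain with kernel [kappa (x :: l)], hence the induction over all [kappa]. *)
Lemma indexed_chain_sum1 (T : finType) (kappa : seq T -> T -> R) (N : nat) :
  (forall l, \sum_x kappa l x = 1) ->
  \sum_(w : N.-tuple T) \prod_(j < N) kappa (take j w) (tnth w j) = 1.
Proof.
elim: N kappa => [|N IH] kappa k1.
  under eq_bigr do rewrite big_ord0.
  by rewrite sumr_const card_tuple expn0.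
have bij : {on predT, bijective (fun p : T * N.-tuple T => cons_tuple p.1 p.2)}.
  apply: onW_bij; exists (fun w => (thead w, behead_tuple w)).
    by case=> x w; congr pair; apply: val_inj.
  by move=> w; apply: val_inj; rewrite [in RHS](tuple_eta w).
pose F (w : N.+1.-tuple T) := \prod_(j < N.+1) kappa (take j w) (tnth w j).
rewrite (reindex _ bij) -(pair_bigA _ (fun x w => F (cons_tuple x w))).
rewrite -(k1 [::]); apply: eq_bigr => x _.
rewrite -[RHS]mulr1 -(IH (fun l => kappa (x :: l)) (fun l => k1 (x :: l))) mulr_sumr.
apply: eq_bigr => w _; rewrite /F big_ord_recl take0; congr (_ * _).
by apply: eq_bigr => j _; rewrite tnthS.
Qed.

Definition ffun_cons (T : Type) n (x : T) (f : {ffun 'I_n -> T}) :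
  {ffun 'I_n.+1 -> T} := [ffun i => oapp f x (unlift ord0 i)].

Lemma ffun_cons0 (T : Type) n (x : T) (f : {ffun 'I_n -> T}) :
  ffun_cons x f ord0 = x.
Proof. by rewrite ffunE unlift_none. Qed.

Lemma ffun_consS (T : Type) n (x : T) (f : {ffun 'I_n -> T}) i :
  ffun_cons x f (lift ord0 i) = f i.
Proof. by rewrite ffunE liftK. Qed.

Lemma big_ffun_cons (T : finType) n (F : {ffun 'I_n.+1 -> T} -> R) :
  \sum_f F f = \sum_x \sum_f F (ffun_cons x f).
Proof.
have bij : {on predT, bijective
    (fun p : T * {ffun 'I_n -> T} => ffun_cons p.1 p.2)}.
  apply: onW_bij; exists (fun f : {ffun 'I_n.+1 -> T} =>
      (f ord0, [ffun i : 'I_n => f (lift ord0 i)])).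
    case=> x f; congr pair; first exact: ffun_cons0.
    by apply/ffunP => i; rewrite ffunE ffun_consS.
  move=> f; apply/ffunP => i; rewrite ffunE.
  by case: unliftP => [j ->|->] //=; rewrite ffunE.
by rewrite (reindex _ bij) -(pair_bigA _ (fun x f => F (ffun_cons x f))).
Qed.

(** Splitting off the first state and action leaves a shorter chain with random starting point.
    Conditioning on that point [s'] makes the induction hypothesis applicable, so [s0] stays
    arbitrary. *)
Lemma markov_chain_sum1 (S A : finType) (H : nat) (f : 'I_H -> S -> A -> S -> R)
    (s0 : S) :
  (forall h s, \sum_a \sum_s' f h s a s' = 1) ->
  \sum_(x : {ffun 'I_H.+1 -> S}) \sum_(a : {ffun 'I_H -> A})
    (x ord0 == s0)%:R *
    \prod_h f h (x (widen_ord (leqnSn H) h)) (a h) (x (lift ord0 h)) = 1.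
Proof.
elim: H f s0 => [|H IH] f s0 f1.
  under eq_bigr do under eq_bigr do rewrite big_ord0 mulr1.
  under eq_bigr do rewrite sumr_const card_ffun card_ord expn0 mulr1n.
  rewrite big_ffun_cons (bigD1 s0) //= [X in _ + X]big1 ?addr0 => [|s /negbTE ns].
    under eq_bigr do rewrite ffun_cons0 eqxx.
    by rewrite sumr_const card_ffun card_ord expn0.
  by rewrite big1 // => g _; rewrite ffun_cons0 ns.
rewrite big_ffun_cons (bigD1 s0) //= [X in _ + X]big1 ?addr0; last first.
  by move=> s /negbTE ns; rewrite big1 // => g _; rewrite big1 // => a _;
    rewrite ffun_cons0 ns mul0r.
pose g h := f (lift ord0 h).
pose Q (y : {ffun 'I_H.+1 -> S}) (a : {ffun 'I_H -> A}) :=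
  \prod_h g h (y (widen_ord (leqnSn H) h)) (a h) (y (lift ord0 h)).
transitivity (\sum_(y : {ffun 'I_H.+1 -> S}) \sum_a0 \sum_(a : {ffun 'I_H -> A})
    f ord0 s0 a0 (y ord0) * Q y a).
  apply: eq_bigr => y _; rewrite big_ffun_cons.
  apply: eq_bigr => a0 _; apply: eq_bigr => a _.
  rewrite ffun_cons0 eqxx mul1r big_ord_recl ffun_cons0 ffun_consS.
  have -> : widen_ord (leqnSn H.+1) ord0 = ord0 by apply: val_inj.
  rewrite ffun_cons0; congr (_ * _); apply: eq_bigr => h _.
  rewrite !ffun_consS.
  have -> : widen_ord (leqnSn H.+1) (lift ord0 h) = lift ord0 (widen_ord (leqnSn H) h).
    exact: val_inj.
  by rewrite ffun_consS.
rewrite -[RHS](f1 ord0 s0) exchange_big; apply: eq_bigr => a0 _.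
transitivity (\sum_s' f ord0 s0 a0 s' *
    \sum_(y : {ffun 'I_H.+1 -> S}) \sum_(a : {ffun 'I_H -> A})
      (y ord0 == s')%:R * Q y a).
  under [RHS]eq_bigr do rewrite mulr_sumr.
  rewrite [RHS]exchange_big; apply: eq_bigr => y _.
  rewrite (bigD1 (y ord0)) //= [X in _ + X]big1 ?addr0.
    by rewrite mulr_sumr; apply: eq_bigr => a _; rewrite eqxx mul1r.
  move=> s' ns; rewrite big1 ?mulr0 // => a _.
  by rewrite eq_sym (negbTE ns) mul0r.
by apply: eq_bigr => s' _; rewrite IH ?mulr1 // => h s; exact: f1.
Qed.

End finite_probability.

(** * Rob-ReL with accurate estimates *)

Section mdp.
Context {R : realType} {S A : finType} {H : nat}.
Implicit Types (M : mdp R S A H) (pi : policy R S A H) (d r z : reward R S A H).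

Lemma traj_pr_ge0 M pi w : 0 <= traj_pr M pi w.
Proof.
by rewrite mulr_ge0 ?ler0n // prodr_ge0 // => h _; rewrite mulr_ge0 ?fdist_ge0.
Qed.

Lemma traj_pr_sum1 M pi : \sum_w traj_pr M pi w = 1.
Proof.
rewrite -(markov_chain_sum1 (f := fun h s a s' => pi s h a * trans M h s a s')
  (init M)) => [|h s].
  by rewrite (pair_bigA _ (fun x a => _ * _)).
under eq_bigr do rewrite -mulr_sumr fdist_sum1 mulr1.
exact: fdist_sum1.
Qed.

Lemma rfe_pr_ge0 (alg : rfe_alg R S A H) e dl M N (w : N.-tuple (traj S A H)) :
  0 <= rfe_pr alg e dl M w.
Proof. by apply: prodr_ge0 => j _; exact: traj_pr_ge0. Qed.

Lemma rfe_pr_sum1 (alg : rfe_alg R S A H) e dl M N :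
  \sum_(w : N.-tuple (traj S A H)) rfe_pr alg e dl M w = 1.
Proof.
apply: (indexed_chain_sum1
  (kappa := fun l => traj_pr M (rfe_explore alg e dl (init M) l))) => l.
exact: traj_pr_sum1.
Qed.

(** Shared by the visits of a trajectory, of a policy and of a nonempty dataset, the latter two
    being convex combinations of the first. The norm bounds on gradients and constraints rest on
    it. *)
Definition occupancy d := (forall x, 0 <= d x <= 1) /\ \sum_x d x = H%:R.

Lemma occupancy_convex (I : finType) (p : I -> R) (d : I -> reward R S A H) :
  (forall i, 0 <= p i) -> \sum_i p i = 1 -> (forall i, occupancy (d i)) ->
  occupancy (\sum_i p i *: d i).
Proof.
move=> p0 p1 od.
have dE x : (\sum_i p i *: d i) x = \sum_i p i * d i x.
  by rewrite sum_ffunE; apply: eq_bigr => i _; rewrite ffunE.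
split=> [x|].
  rewrite dE; apply/andP; split.
    by apply: sumr_ge0 => i _; rewrite mulr_ge0 //; case: (od i) => /(_ x)/andP[].
  rewrite -p1; apply: ler_sum => i _; rewrite ler_piMr //.
  by case: (od i) => /(_ x)/andP[].
under eq_bigr do rewrite dE.
transitivity (\sum_i p i * H%:R); last by rewrite -mulr_suml p1 mul1r.
rewrite exchange_big; apply: eq_bigr => i _.
by rewrite -mulr_sumr; case: (od i) => _ ->.
Qed.

Lemma visit_traj_occupancy (w : traj S A H) : occupancy (visit_traj R w).
Proof.
split=> [[[s a] h]|]; first by rewrite ffunE ler0n lern1 leq_b1.
transitivity (\sum_(sa : S * A) \sum_(h < H)
    ((state_at w h == sa.1) && (action_at w h == sa.2))%:R : R).
  by rewrite pair_bigA; apply: eq_bigr => -[[s a] h] _; rewrite ffunE.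
rewrite exchange_big -[RHS]mulr1 mulr_natl -[in RHS](card_ord H) -sumr_const.
apply: eq_bigr => h _.
rewrite (bigD1 (state_at w h, action_at w h)) //= !eqxx big1 ?addr0 //.
move=> [s a]; rewrite xpair_eqE /= => /negbTE.
by rewrite eq_sym (eq_sym a) => ->.
Qed.

Lemma visitE M pi : visit M pi = \sum_w traj_pr M pi w *: visit_traj R w.
Proof.
apply/ffunP => -[[s a] h]; rewrite sum_ffunE ffunE prE.
apply: eq_bigr => w _; rewrite !ffunE; congr (_ * _%:R).
congr nat_of_bool; apply/asboolP/andP => -[].
  by move=> -> ->; rewrite !eqxx.
by move=> /eqP -> /eqP ->.
Qed.

Lemma visit_occupancy M pi : occupancy (visit M pi).
Proof.
rewrite visitE; apply: occupancy_convex => [w||w].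
- exact: traj_pr_ge0.
- exact: traj_pr_sum1.
- exact: visit_traj_occupancy.
Qed.

Lemma occupancy_dot d r : occupancy d -> rewards r -> 0 <= dot d r <= H%:R.
Proof.
move=> [d01 <-] r01; rewrite sumr_ge0 => [|x _]; last first.
  by have /andP[? ?] := d01 x; have /andP[? ?] := r01 x; rewrite mulr_ge0.
apply: ler_sum => x _.
by have /andP[? ?] := d01 x; have /andP[? ?] := r01 x; rewrite ler_piMr.
Qed.

Lemma occupancy_sub_dot d d' r : occupancy d -> occupancy d' -> rewards r ->
  `|dot (d - d') r| <= H%:R.
Proof.
move=> od od' br; rewrite dotBl ler_norml.
by have := occupancy_dot od br; have := occupancy_dot od' br; lra.
Qed.

(** Entrywise, [(x - y) ^+ 2 <= x + y] on the unit interval. This is the origin of the value 2H of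
    [B]. *)
Lemma occupancy_sub_sqnorm d d' : occupancy d -> occupancy d' ->
  dot (d - d') (d - d') <= 2 * H%:R.
Proof.
move=> [d01 dH] [d01' dH'].
have -> : 2 * H%:R = \sum_x (d x + d' x) by rewrite big_split /= dH dH'; lra.
apply: ler_sum => x _; rewrite !ffunE.
by have := d01 x; have := d01' x; nra.
Qed.

Lemma J_range M pi r : rewards r -> 0 <= J M pi r <= H%:R.
Proof. by move=> br; apply: occupancy_dot => //; exact: visit_occupancy. Qed.

Lemma J_le_Jstar M pi r : rewards r -> J M pi r <= Jstar M r.
Proof.
move=> br; apply: ub_le_sup; last by exists pi.
by exists H%:R => _ [pi' _ <-]; case/andP: (J_range M pi' br).
Qed.

Section planner.
Variable plan : mdp R S A H -> reward R S A H -> policy R S A H.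
Hypothesis planP : optimal_planner plan.

Lemma Jstar_range M r : rewards r -> 0 <= Jstar M r <= H%:R.
Proof. by move=> br; rewrite -planP // J_range. Qed.

(** The return of the policy planned for [r] is linear in the reward, touches [Jstar] at [r] and
    stays below it elsewhere. *)
Lemma Jstar_subgradient M r z : rewards r -> rewards z ->
  Jstar M r + dot (visit M (plan M r)) (z - r) <= Jstar M z.
Proof.
move=> br bz; rewrite dotBr -(planP M br) addrC subrK.
exact: J_le_Jstar.
Qed.

(** Going from the supremum to one reward requires the set to be bounded, here by H, because [sup]
    of an unbounded set is a default value. *)
Lemma rfe_Jstar_close (alg : rfe_alg R S A H) e dl M w r : rewards r ->
  sup [set `|Jstar (rfe_mdp alg e dl M w) r' - Jstar M r'|
      | r' in @rewards R S A H] <= e ->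
  `|Jstar (rfe_mdp alg e dl M w) r - Jstar M r| <= e.
Proof.
move=> br; apply: le_trans; apply: ub_le_sup; last by exists r.
exists H%:R => _ [r' br' <-]; rewrite ler_norml.
by have := Jstar_range (rfe_mdp alg e dl M w) br'; have := Jstar_range M br'; lra.
Qed.

End planner.
End mdp.

(** * The feedback as convex constraints on the reward, with subgradients *)

Section feedback_constraints.
Context {R : realType} {S A : finType} {H mD mTC mPC : nat}.
Variable P : problem R S A H mD mTC mPC.
Variable plan : mdp R S A H -> reward R S A H -> policy R S A H.
Hypothesis planP : optimal_planner plan.
Variables (dv : source mD mPC -> reward R S A H) (MD : 'I_mD -> mdp R S A H).

Definition constr_subgrad (r : reward R S A H) (c : feedback mD mTC mPC) :
    reward R S A H :=
  match c with
  | inl (inl i) => visit (MD i) (plan (MD i) r) - dv (src_D mPC i)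
  | inl (inr i) => visit_traj R (TC_traj1 P i) - visit_traj R (TC_traj2 P i)
  | inr i => dv (src_PC mD i false) - dv (src_PC mD i true)
  end.

Lemma lagr_grad_rE r l :
  lagr_grad_r P plan dv MD r l =
  obj_grad dv + \sum_c l c *: constr_subgrad r c.
Proof. by rewrite /lagr_grad_r !big_sumType /= !addrA. Qed.

Lemma pdsmE alpha s K b :
  pdsm P plan dv MD alpha s K b =
  dot (obj_grad dv)
    (primal_mean b alpha s (obj_grad dv) (constr P dv MD) constr_subgrad K).
Proof.
have step_eq : pdsm_step P plan dv MD alpha s b =1
    primal_dual_step b alpha s (obj_grad dv) (constr P dv MD) constr_subgrad.
  by move=> rl; rewrite /pdsm_step lagr_grad_rE.
have iter_eq k := eq_iter step_eq k (0, 0).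
transitivity (dot (obj_grad dv) (K%:R^-1 *: \sum_(k < K)
  (iter k (pdsm_step P plan dv MD alpha s b) (0, 0)).1)).
  reflexivity.
rewrite (eq_bigr _ (fun (k : 'I_K) _ => congr1 fst (iter_eq k))).
reflexivity.
Qed.

Lemma constr_subgradient r z c : rewards r -> rewards z ->
  constr P dv MD r c + dot (constr_subgrad r c) (z - r) <= constr P dv MD z c.
Proof.
move=> br bz; case: c => [[i|i]|i]; rewrite !ffunE /=.
- by have := Jstar_subgradient planP (MD i) br bz; rewrite dotBl !dotBr; lra.
- by rewrite -dotDr (addrC r) subrK.
- by rewrite -dotDr (addrC r) subrK.
Qed.

(** Average the subgradient inequalities at the mixed point, evaluated at [r] and at [z]: the linear
    terms cancel. *)
Lemma constr_convex r z (th : R) c : rewards r -> rewards z -> 0 <= th <= 1 ->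
  constr P dv MD ((1 - th) *: r + th *: z) c <=
  (1 - th) * constr P dv MD r c + th * constr P dv MD z c.
Proof.
move=> br bz th01; set y := (1 - th) *: r + th *: z.
have bY : rewards y by exact: box_convex.
have := constr_subgradient c bY br; have := constr_subgradient c bY bz.
have yE u : dot u y = (1 - th) * dot u r + th * dot u z by rewrite dotDr !dotZr.
rewrite !dotBr yE.
move: (dot _ r) (dot _ z) => p q h1 h2; case/andP: th01 => th0 th1.
have th1' : 0 <= 1 - th by lra.
have := ler_wpM2l th0 h1; have := ler_wpM2l th1' h2; lra.
Qed.

Hypothesis dv_occ : forall q, occupancy (dv q).

Lemma obj_grad_sqnorm : dot (obj_grad dv) (obj_grad dv) <= 2 * H%:R.
Proof. exact: occupancy_sub_sqnorm. Qed.

Lemma constr_subgrad_sqnorm r c :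
  dot (constr_subgrad r c) (constr_subgrad r c) <= 2 * H%:R.
Proof.
case: c => [[i|i]|i]; apply: occupancy_sub_sqnorm => //.
- exact: visit_occupancy.
- exact: visit_traj_occupancy.
- exact: visit_traj_occupancy.
Qed.

Lemma constr_norm r c : rewards r -> `|constr P dv MD r c| <= 2 * H%:R.
Proof.
have H0 : 0 <= H%:R :> R by rewrite ler0n.
move=> br; case: c => [[i|i]|i]; rewrite !ffunE /=.
- have := Jstar_range planP (MD i) br; have := D_t_range P i.
  have := occupancy_dot (dv_occ (src_D mPC i)) br; rewrite ler_norml; lra.
- have := occupancy_sub_dot (visit_traj_occupancy (TC_traj1 P i))
    (visit_traj_occupancy (TC_traj2 P i)) br; lra.
- have := occupancy_sub_dot (dv_occ (src_PC mD i false))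
    (dv_occ (src_PC mD i true)) br; lra.
Qed.

End feedback_constraints.

Lemma src_visit_occupancy (R : realType) (S A : finType) (H mD mTC mPC : nat)
    (P : problem R S A H mD mTC mPC) q : occupancy (src_visit P q).
Proof. exact: visit_occupancy. Qed.

(** No constraint function falls below -H on the rewards. A single constraint thus bounds [xi]; when
    there is none, the bound has to come from a hypothesis. *)
Lemma slater_le (R : realType) (S A : finType) (H mD mTC mPC : nat)
    (P : problem R S A H mD mTC mPC) (xi : R) :
  slater P xi -> feedback mD mTC mPC -> xi <= H%:R.
Proof.
move=> [r br sl] c; have := sl c; case: c => [[i|i]|i]; rewrite ffunE /=.
- have := J_le_Jstar (D_mdp P i) (D_pol P i) br; have := D_t_range P i.
  rewrite /J /src_visit /=; lra.
- have := occupancy_sub_dot (visit_traj_occupancy (TC_traj1 P i))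
    (visit_traj_occupancy (TC_traj2 P i)) br; rewrite ler_norml; lra.
- have := occupancy_sub_dot (src_visit_occupancy P (src_PC mD i false))
    (src_visit_occupancy P (src_PC mD i true)) br; rewrite ler_norml; lra.
Qed.

Lemma chebyshev_radius (R : realType) (B : set R) (C : R) :
  B !=set0 -> (forall y, B y -> `|y| <= C) ->
  inf [set sup [set `|x - y| | y in B] | x in setT] = (sup B - inf B) / 2.
Proof.
move=> [y0 By0] BC.
have yC y : B y -> - C <= y <= C by move=> /BC; rewrite ler_norml.
have supB : has_sup B by split; [exists y0 | exists C => y /yC/andP[]].
have infB : has_inf B by split; [exists y0 | exists (- C) => y /yC/andP[]].
have dist_ub x : has_ubound [set `|x - y| | y in B].
  exists (`|x| + C) => _ [y By <-].
  by rewrite (le_trans (ler_normB _ _)) // lerD2l BC.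
have lb x : (sup B - inf B) / 2 <= sup [set `|x - y| | y in B].
  set d := sup [set `|x - y| | y in B].
  have hd y : B y -> x - d <= y <= x + d.
    move=> By; have : `|x - y| <= d by apply: ub_le_sup; [exact: dist_ub | exists y].
    by rewrite ler_norml; lra.
  have : sup B <= x + d by apply: ge_sup; [exists y0 | move=> y /hd/andP[]].
  have : x - d <= inf B by apply: lb_le_inf; [exists y0 | move=> y /hd/andP[]].
  lra.
apply: le_anti; apply/andP; split; last first.
  by apply: lb_le_inf; [exists (sup [set `|0 - y| | y in B]), 0 | move=> _ [x _ <-]].
pose x := (sup B + inf B) / 2.
apply: (@le_trans _ _ (sup [set `|x - y| | y in B])).
  apply: ge_inf; last by exists x.
  by exists ((sup B - inf B) / 2) => _ [x' _ <-].
apply: ge_sup; first by exists `|x - y0|, y0.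
move=> _ [y By <-]; rewrite ler_norml /x.
have : y <= sup B by apply: ub_le_sup => //; case: supB.
have : inf B <= y by apply: ge_inf => //; case: infB.
lra.
Qed.

(** 13/16 is 1/4 + 1/16 + 1/2: initial distance, primal steps, multiplier steps. The last needs
    [h * m / q <= 4] for [q = (1 + s * Num.sqrt m) ^+ 2], which follows from [s ^+ 2 >= N / 4]; this
    is what the summand SAH/4 in the radius provides. *)
Lemma step_size_gap (R : realType) (h m N s eps alpha K : R) :
  1 <= h -> 0 <= m -> h <= N -> 0 < s -> N / 4 <= s ^+ 2 -> 0 < eps ->
  alpha = eps / (16 * h * (1 + s * Num.sqrt m) ^+ 2) ->
  0 < K -> 32 * h * (1 + s * Num.sqrt m) ^+ 2 * (N + s ^+ 2) / eps ^+ 2 <= K ->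
  (N + s ^+ 2) / (2 * alpha * K) + alpha / 2 *
    (2 * h * (1 + s * Num.sqrt m) ^+ 2 + m * (2 * h) ^+ 2) <= 13 / 16 * eps.
Proof.
move=> h1 m0 hN s0 sN e0.
have : 1 + s ^+ 2 * m <= (1 + s * Num.sqrt m) ^+ 2.
  rewrite sqrrD exprMn sqr_sqrtr // expr1n mul1r.
  have : 0 <= s * Num.sqrt m by rewrite mulr_ge0 ?sqrtr_ge0 // ltW.
  lra.
move: ((1 + _) ^+ 2) => q qm -> K0.
have sm0 : 0 <= s ^+ 2 * m by rewrite mulr_ge0 ?sqr_ge0.
have q0 : 0 < q by lra.
have h0 : 0 < h by lra.
rewrite ler_pdivrMr ?exprn_gt0 // => Kq.
have -> : (N + s ^+ 2) / (2 * (eps / (16 * h * q)) * K) =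
    (8 * h * q * (N + s ^+ 2)) / (eps * K).
  by field; rewrite !gt_eqF.
have -> : eps / (16 * h * q) / 2 * (2 * h * q + m * (2 * h) ^+ 2) =
    eps / 16 + eps * (h * m / q) / 8.
  by field; rewrite !gt_eqF.
have : (8 * h * q * (N + s ^+ 2)) / (eps * K) <= eps / 4.
  by rewrite ler_pdivrMr ?mulr_gt0 //; nra.
have : h * m / q <= 4 by rewrite ler_pdivrMr //; nra.
by move=> /(ler_wpM2l (ltW e0)); lra.
Qed.

Section correctness.
Context {R : realType} {S A : finType} {H mD mTC mPC : nat}.
Variable P : problem R S A H mD mTC mPC.
Variable plan : mdp R S A H -> reward R S A H -> policy R S A H.
Variables (dv : source mD mPC -> reward R S A H) (MD : 'I_mD -> mdp R S A H).
Variables (eps xi s alpha tau : R) (K : nat) (rstar : reward R S A H).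

Let N : R := #|S|%:R * #|A|%:R * H%:R.
Let m : R := (mD + mTC + mPC)%:R.
Let f r := dot (obj_grad (src_visit P)) r.

Hypothesis planP : optimal_planner plan.
Hypotheses (S_gt0 : (0 < #|S|)%N) (A_gt0 : (0 < #|A|)%N) (H_gt0 : (0 < H)%N).
Hypotheses (eps_bound : 0 < eps <= 2 * H%:R) (xi_bound : 0 < xi <= H%:R).
Hypothesis sE : s = 4 * H%:R / xi + Num.sqrt ((4 * H%:R / xi) ^+ 2 + N / 4).
Hypothesis alphaE : alpha = eps / (16 * H%:R * (1 + s * Num.sqrt m) ^+ 2).
Hypothesis tauE : tau = eps * xi / (128 * H%:R).
Hypothesis K_gt0 : (0 < K)%N.
Hypothesis K_ge :
  32 * H%:R * (1 + s * Num.sqrt m) ^+ 2 * (N + s ^+ 2) / eps ^+ 2 <= K%:R.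
Hypotheses (slaterP : slater P xi) (rstarP : feasible P rstar).
Hypothesis dv_occ : forall q, occupancy (dv q).
Hypothesis dv_close : forall q r, rewards r ->
  `|dot (dv q) r - dot (src_visit P q) r| <= tau.
Hypothesis MD_close : forall i r, rewards r ->
  `|Jstar (MD i) r - Jstar (D_mdp P i) r| <= tau.

Let H0 : 0 < H%:R :> R. Proof. by rewrite ltr0n. Qed.

Let values := [set f r | r in feasible P].

Let f_norm r : rewards r -> `|f r| <= H%:R.
Proof. by move=> br; apply: occupancy_sub_dot => //; exact: src_visit_occupancy. Qed.

Let s_ge : 8 * H%:R / xi <= s /\ N / 4 <= s ^+ 2.
Proof.
have /andP[x0 _] := xi_bound.
have a0 : 0 <= 4 * H%:R / xi by rewrite divr_ge0 ?mulr_ge0 // ltW.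
have N0 : 0 <= N / 4 by rewrite divr_ge0 ?mulr_ge0.
have h1 : 4 * H%:R / xi <= Num.sqrt ((4 * H%:R / xi) ^+ 2 + N / 4).
  by rewrite -[leLHS]ger0_norm // -sqrtr_sqr ler_sqrt ?addr_ge0 ?sqr_ge0 // lerDl.
have h2 : Num.sqrt (N / 4) <= s.
  by rewrite sE ler_wpDl // ler_sqrt ?addr_ge0 ?sqr_ge0 // lerDr sqr_ge0.
split; first by rewrite sE; lra.
by rewrite -[leLHS]sqr_sqrtr // ler_pXn2r ?nnegrE ?sqrtr_ge0 //
  (le_trans _ h2) ?sqrtr_ge0.
Qed.

Let pdsm_close b (v : R) :
  (forall z, feasible P z -> v <= (if b then 1 else -1) * f z) ->
  (exists2 z, feasible P z & (if b then 1 else -1) * f z <= v + eps / 32) ->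
  `|(if b then 1 else -1) * pdsm P plan dv MD alpha s K b - v| <= eps.
Proof.
move=> v_lb [z [bz fz] v_approx]; have [rs rs_box rs_slater] := slaterP.
have /andP[e0 e2] := eps_bound; have /andP[x0 xH] := xi_bound.
have [s1 s2] := s_ge.
have H1 : 1 <= H%:R :> R by rewrite ler1n.
have s0 : 0 < s by apply: lt_le_trans s1; rewrite divr_gt0 ?mulr_gt0.
have alpha0 : 0 < alpha.
  have sm0 : 0 <= s * Num.sqrt m by rewrite mulr_ge0 ?sqrtr_ge0 // ltW.
  by rewrite alphaE divr_gt0 ?mulr_gt0 ?exprn_gt0 // ltr_pwDl.
have tau0 : 0 <= tau by rewrite tauE divr_ge0 ?mulr_ge0 // ltW.
(* 128 is 2 * 2 * 32: a policy comparison involves two estimates, so constraints are off by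
   [2 * tau]; the objective oscillates by at most 2H; mixing may cost [eps / 32]. *)
have Htau : H%:R * tau = eps * xi / 128 by rewrite tauE; field; rewrite gt_eqF.
have tau_xi : 2 * tau <= xi.
  rewrite -(ler_pM2l H0) mulrCA Htau; nra.
have tau_eps : 2 * tau <= eps / 32.
  rewrite -(ler_pM2l H0) mulrCA Htau; nra.
have card_m : #|{: feedback mD mTC mPC}|%:R = m.
  by rewrite !card_sum !card_ord.
have card_N : #|{: S * A * 'I_H}|%:R = N by rewrite !card_prod card_ord !natrM.
rewrite pdsmE.
apply: (@primal_dual_value _ _ _ b alpha s (2 * H%:R) (obj_grad dv)
  (obj_grad (src_visit P)) (constr P dv MD) (constr P (src_visit P) (D_mdp P))
  (constr_subgrad P plan dv MD) eps xi (2 * tau) (2 * H%:R) v rs K) => //.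
- exact: obj_grad_sqnorm.
- by move=> r t _; exact: constr_subgrad_sqnorm.
- by move=> r t; exact: (constr_norm P planP).
- by move=> r y t; exact: constr_subgradient.
- by rewrite mulr_ge0 // ltW.
- have -> : 2 * H%:R * (2 * tau) = 4 * (H%:R * tau) by ring.
  by rewrite Htau; lra.
- have := ler_wpM2r (ltW x0) s1; rewrite divfK ?gt_eqF //; lra.
- rewrite card_m card_N; apply: step_size_gap => //.
  + by rewrite -[leLHS]mul1r ler_wpM2r ?ler0n // -natrM ler1n muln_gt0 S_gt0.
  + by rewrite ltr0n.
- move=> r br; rewrite /obj_grad !dotBl.
  have := dv_close (src_tgt mD mPC false) br.
  have := dv_close (src_tgt mD mPC true) br.
  rewrite !ler_norml; lra.
- move=> r t br; case: t => [[i|i]|i]; rewrite !ffunE /=.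
  + have := dv_close (src_D mPC i) br; have := MD_close i br.
    rewrite !ler_norml; lra.
  + by rewrite subrr normr0 mulr_ge0.
  + have := dv_close (src_PC mD i false) br.
    have := dv_close (src_PC mD i true) br.
    rewrite !dotBl !ler_norml; lra.
- by move=> r y th t; exact: (constr_convex P planP).
- move=> r y br by_; have := f_norm br; have := f_norm by_.
  by rewrite /f !ler_norml; lra.
- by move=> y by_ gy; exact: v_lb.
- by exists z.
Qed.

Let values0 : values !=set0. Proof. by exists (f rstar), rstar. Qed.

Let values_norm y : values y -> `|y| <= H%:R.
Proof. by move=> [r [br _] <-]; exact: f_norm. Qed.

Let values_sup : has_sup values.
Proof.
split=> //; exists H%:R => y /values_norm; rewrite ler_norml.
by case/andP.
Qed.

Let values_inf : has_inf values.
Proof.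
split=> //; exists (- H%:R) => y /values_norm; rewrite ler_norml.
by case/andP.
Qed.

Let pdsm_max : `|pdsm P plan dv MD alpha s K false - sup values| <= eps.
Proof.
have /andP[e0 _] := eps_bound.
rewrite -normrN opprD -mulN1r; apply: (@pdsm_close false (- sup values)).
- move=> z fz; rewrite mulN1r lerN2; apply: ub_le_sup; last by exists z.
  by case: values_sup.
- have e32 : 0 < eps / 32 by lra.
  have [_ [z fz <-] hz] := sup_adherent e32 values_sup.
  by exists z => //; rewrite mulN1r; lra.
Qed.

Let pdsm_min : `|pdsm P plan dv MD alpha s K true - inf values| <= eps.
Proof.
have /andP[e0 _] := eps_bound.
rewrite -[pdsm _ _ _ _ _ _ _ _]mul1r; apply: (@pdsm_close true (inf values)).
- move=> z fz; rewrite mul1r; apply: ge_inf; last by exists z.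
  by case: values_inf.
- have e32 : 0 < eps / 32 by lra.
  have [_ [z fz <-] hz] := inf_adherent e32 values_inf.
  by exists z => //; rewrite mul1r ltW.
Qed.

Let unif_eq : uninformativeness P = (sup values - inf values) / 2.
Proof.
rewrite -(chebyshev_radius values0 values_norm).
rewrite /uninformativeness; congr inf; congr image; apply/funext => x.
congr sup; rewrite image_comp; congr image; apply/funext => r.
by rewrite /= /loss /f /obj_grad dotBl.
Qed.

Lemma robrel_correct :
  loss P rstar ((pdsm P plan dv MD alpha s K false
    + pdsm P plan dv MD alpha s K true) / 2) <= uninformativeness P + eps /\
  `|uninformativeness P - (pdsm P plan dv MD alpha s K false
    - pdsm P plan dv MD alpha s K true) / 2| <= eps.
Proof.
have := pdsm_max; have := pdsm_min; rewrite unif_eq /loss.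
have -> : J (tgt P) (tgt_pol1 P) rstar - J (tgt P) (tgt_pol2 P) rstar = f rstar.
  by rewrite /f /obj_grad dotBl.
have : f rstar <= sup values.
  by apply: ub_le_sup; [case: values_sup | exists rstar].
have : inf values <= f rstar.
  by apply: ge_inf; [case: values_inf | exists rstar].
rewrite !ler_norml => h1 h2 /andP[h3 h4] /andP[h5 h6]; split; lra.
Qed.

End correctness.

(** * Concentration of the estimates *)

Lemma box_dot_norm_le (R : realType) (X : finType) (v r : vec R X) (tau : R) :
  (forall (b : bool) (B : {set X}),
     (-1) ^+ b * dot v [ffun x => (x \in B)%:R] <= tau) ->
  (forall x, 0 <= r x <= 1) -> `|dot v r| <= tau.
Proof.
move=> vB r01.
have bound (u : vec R X) :
    dot u r <= dot u [ffun x => (x \in [set y | 0 <= u y]%SET)%:R].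
  apply: ler_sum => x _; rewrite ffunE inE; have /andP[r0 r1] := r01 x.
  by case: (leP 0 (u x)) => ux; rewrite ?mulr1 ?mulr0; nra.
rewrite ler_norml lerNl -dotNl; apply/andP; split.
  apply: le_trans (bound _) _; have := vB true [set y | 0 <= (- v) y]%SET.
  by rewrite expr1 mulN1r -dotNl.
apply: le_trans (bound _) _; have := vB false [set y | 0 <= v y]%SET.
by rewrite expr0 mul1r.
Qed.

Section concentration.
Context {R : realType} {S A : finType} {H mD mTC mPC : nat}.
Variable P : problem R S A H mD mTC mPC.
Variables (alg : rfe_alg R S A H) (e dl : R).
Variables (n : source mD mPC -> nat) (N : nat).
Let X : finType := (S * A * 'I_H)%type.
Let sample := sample S A H n N.
Let data : finType := {q : source mD mPC & 'I_(n q)}.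

Let mu1 (j : data) := traj_pr (src_mdp P (tag j)) (src_pol P (tag j)).
Let mu2 (i : 'I_mD) (w : N.-tuple (traj S A H)) := rfe_pr alg e dl (D_mdp P i) w.

Let mu1_ge0 j w : 0 <= mu1 j w. Proof. exact: traj_pr_ge0. Qed.
Let mu1_sum1 j : \sum_w mu1 j w = 1. Proof. exact: traj_pr_sum1. Qed.
Let mu2_ge0 i w : 0 <= mu2 i w. Proof. exact: rfe_pr_ge0. Qed.
Let mu2_sum1 i : \sum_w mu2 i w = 1. Proof. exact: rfe_pr_sum1. Qed.

Let sample_prE : sample_pr P alg e dl (n := n) (N := N) =
  fun w => product_pr mu1 w.1 * product_pr mu2 w.2.
Proof. by []. Qed.

Lemma sample_pr_ge0 (w : sample) : 0 <= sample_pr P alg e dl w.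
Proof. by rewrite sample_prE mulr_ge0 ?product_pr_ge0. Qed.

Lemma sample_pr_sum1 : \sum_(w : sample) sample_pr P alg e dl w = 1.
Proof.
rewrite sample_prE -(pair_bigA _ (fun x y => product_pr mu1 x * product_pr mu2 y)).
rewrite -(product_pr_sum1 mu1_sum1); apply: eq_bigr => x _.
by rewrite -mulr_sumr product_pr_sum1 ?mulr1.
Qed.

Lemma pr_exploration i (E : N.-tuple (traj S A H) -> Prop) :
  pr (sample_pr P alg e dl (n := n) (N := N)) (fun w => E (w.2 i)) =
  pr (rfe_pr alg e dl (D_mdp P i) (N := N)) E.
Proof.
rewrite -(pr_marginal mu2_sum1 i) sample_prE.
exact: (pr_snd (product_pr mu2) (fun w => E (w i)) (product_pr_sum1 mu1_sum1)).
Qed.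

Let big_dataset (q : source mD mPC) (F : data -> R) :
  \sum_(j | tag j == q) F j =
  \sum_(j < n q) F (Tagged (fun q => 'I_(n q)) j).
Proof.
transitivity (\sum_(q' | q' == q) \sum_(j < n q') F (Tagged (fun q => 'I_(n q)) j)).
  rewrite sig_big_dep /=; apply: eq_big => [j|[q' j] _ //].
  by rewrite andbT.
by rewrite big_pred1_eq.
Qed.

Let card_dataset (q : source mD mPC) :
  #|[pred j : data | tag j == q]|%:R = (n q)%:R :> R.
Proof.
rewrite -sum1_card natr_sum (eq_bigl (fun j : data => tag j == q)) //.
by rewrite big_dataset sumr_const card_ord.
Qed.

(** The boolean is a sign, so that a one-sided tail bound covers both directions. *)
Definition deviation (tau : R) (q : source mD mPC) (bB : bool * {set X})
    (w : sample) : Prop :=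
  tau < (-1) ^+ bB.1 * dot (emp_visit R w q - src_visit P q)
                          [ffun x => (x \in bB.2)%:R].

Lemma deviation_bound (tau : R) q bB : (0 < H)%N -> (0 < n q)%N ->
  0 <= tau / H%:R <= 2 ->
  pr (sample_pr P alg e dl (n := n) (N := N)) (deviation tau q bB)
  <= expR (- ((n q)%:R * (tau / H%:R) ^+ 2 / 8)).
Proof.
move=> H0 n0 t02; case: bB => b B; pose r : vec R X := [ffun x => (x \in B)%:R].
have br : rewards r by move=> x; rewrite ffunE ler0n lern1 leq_b1.
have H0' : 0 < H%:R :> R by rewrite ltr0n.
have n0' : 0 < (n q)%:R :> R by rewrite ltr0n.
pose Y (w : traj S A H) : R :=
  (-1) ^+ b * (dot (visit_traj R w) r - dot (src_visit P q) r) / H%:R.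
have Y1 w : `|Y w| <= 1.
  rewrite !normrM normrX normrN1 expr1n mul1r normfV (ger0_norm (ltW H0')).
  rewrite ler_pdivrMr // mul1r -dotBl occupancy_sub_dot //.
    exact: visit_traj_occupancy.
  exact: src_visit_occupancy.
have EY j : tag j == q -> \sum_w mu1 j w * Y w = 0.
  move=> /eqP jq; transitivity ((-1) ^+ b / H%:R * \sum_w
      (mu1 j w * dot (visit_traj R w) r - mu1 j w * dot (src_visit P q) r)).
    by rewrite mulr_sumr; apply: eq_bigr => w _; rewrite /Y; ring.
  rewrite sumrB -mulr_suml mu1_sum1 mul1r /src_visit visitE dot_suml.
  apply/eqP; rewrite mulf_eq0 subr_eq0; apply/orP; right; apply/eqP.
  by apply: eq_bigr => w _; rewrite dotZl /mu1 jq.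
have := hoeffding_bound (I := data) mu1_ge0 mu1_sum1 EY Y1 t02.
rewrite card_dataset; apply: le_trans.
rewrite sample_prE -(pr_fst (product_pr mu1) _ (product_pr_sum1 mu2_sum1)).
apply: pr_le => [w|w]; first by rewrite mulr_ge0 ?product_pr_ge0.
rewrite /deviation big_dataset /= -/r => h.
have -> : \sum_(j < n q) Y (w.1 (Tagged (fun q => 'I_(n q)) j)) =
    (n q)%:R * ((-1) ^+ b * dot (emp_visit R w q - src_visit P q) r / H%:R).
  rewrite /Y -mulr_suml -mulr_sumr sumrB sumr_const card_ord -mulr_natl.
  rewrite /emp_visit dotBl dotZl dot_suml.
  by field; rewrite !gt_eqF.
by rewrite ltr_pM2l // ltr_pM2r ?invr_gt0.
Qed.

Let Q : nat := #|{: source mD mPC}|.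

(** Half of [dlt] goes to the datasets and half to the explorations. The [+ 1] in [dl] keeps it
    positive when there are no demonstrations. *)
Lemma sample_concentration (dlt tau : R) (n0 : nat) :
  (0 < H)%N -> (0 < n0)%N -> (forall q, n0 <= n q)%N ->
  0 < dlt -> 0 <= tau / H%:R <= 2 -> dl = dlt / (2 * (mD%:R + 1)) ->
  (forall i, 1 - dl <= pr (rfe_pr alg e dl (D_mdp P i) (N := N))
     (fun w => sup [set `|Jstar (rfe_mdp alg e dl (D_mdp P i) w) r
         - Jstar (D_mdp P i) r| | r in @rewards R S A H] <= e)) ->
  #|X|%:R + 2 + ln Q%:R + ln dlt^-1 <= n0%:R * (tau / H%:R) ^+ 2 / 8 ->
  1 - dlt <= pr (sample_pr P alg e dl (n := n) (N := N)) (fun w =>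
    (forall q r, rewards r ->
       `|dot (emp_visit R w q) r - dot (src_visit P q) r| <= tau) /\
    (forall i, sup [set `|Jstar (emp_mdp P alg e dl w i) r
         - Jstar (D_mdp P i) r| | r in @rewards R S A H] <= e)).
Proof.
move=> H0 n00 nn dlt0 t02 dlE rfeP budget.
pose E1 w := exists qb : source mD mPC * (bool * {set X}), deviation tau qb.1 qb.2 w.
pose E2 (w : sample) := exists i, ~ sup [set `|Jstar (emp_mdp P alg e dl w i) r
         - Jstar (D_mdp P i) r| | r in @rewards R S A H] <= e.
rewrite (pr_complement _ sample_pr_sum1) lerD2l lerN2.
apply: (@le_trans _ _ (pr (sample_pr P alg e dl (n := n) (N := N))
    (fun w => E1 w \/ E2 w))).
  apply: pr_le => [w|w bad]; first exact: sample_pr_ge0.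
  apply: contra_notP bad => /not_orP[nE1 nE2]; split=> [q r br|i].
    rewrite -dotBl; apply: box_dot_norm_le => // b B; rewrite leNgt.
    by apply/negP => h; apply: nE1; exists (q, (b, B)).
  by apply: contrapT => h; apply: nE2; exists i.
apply: le_trans (union_bound2 _ _ sample_pr_ge0) _.
have Q0 : 0 < Q%:R :> R.
  by rewrite ltr0n; apply/card_gt0P; exists (src_tgt mD mPC true).
have -> : dlt = dlt / 2 + dlt / 2 by lra.
apply: lerD.
  apply: le_trans (union_bound _ sample_pr_ge0) _.
  apply: (@le_trans _ _ (\sum_(qb : source mD mPC * (bool * {set X}))
      expR (- (#|X|%:R + 2 + ln Q%:R + ln dlt^-1)))).
    apply: ler_sum => -[q bB] _.
    apply: le_trans (deviation_bound _ _ _ _) _ => //=.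
      exact: leq_trans (nn q).
    rewrite ler_expR lerN2; apply: le_trans budget _.
    by rewrite ler_pM2r ?invr_gt0 // ler_wpM2r ?sqr_ge0 // ler_nat.
  (* As e >= 2, the summand [#|X|] of the budget pays for the subsets, and the summand 2 for the two
     signs and for halving [dlt]. *)
  have e2 : 2 <= expR 1 :> R by rewrite -[leLHS]/(1 + 1) expR_ge1Dx.
  have cardB : #|{: {set X}}|%:R = 2 ^+ #|X| :> R.
    by rewrite -[#|{: {set X}}|]cardsT -powersetT card_powerset cardsT natrX.
  have cardI : #|{: source mD mPC * (bool * {set X})}|%:R =
      Q%:R * (2 * 2 ^+ #|X|) :> R.
    by rewrite 2!card_prod card_bool !natrM; congr (_ * (_ * _)); exact: cardB.
  rewrite sumr_const -[leLHS]mulr_natl cardI.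
  rewrite !opprD !expRD !expRN !lnK ?posrE ?invr_gt0 // invrK.
  have pe : 2 ^+ #|X| <= expR #|X|%:R :> R.
    by rewrite -[X in expR X]mulr1 expRM_natl lerXn2r ?nnegrE ?expR_ge0.
  have -> : Q%:R * (2 * 2 ^+ #|X|) *
      ((expR #|X|%:R)^-1 * ((expR 1)^-1 / expR 1) / Q%:R * dlt) =
      (2 ^+ #|X| / expR #|X|%:R) * (2 / (expR 1 * expR 1)) * dlt.
    by field; rewrite !gt_eqF ?expR_gt0.
  have q1 : 2 ^+ #|X| / expR #|X|%:R <= 1 :> R.
    by rewrite ler_pdivrMr ?expR_gt0 // mul1r.
  have q2 : 2 / (expR 1 * expR 1) <= 1 / 2 :> R.
    by rewrite ler_pdivrMr ?mulr_gt0 ?expR_gt0 //; nra.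
  have q10 : 0 <= 2 ^+ #|X| / expR #|X|%:R :> R.
    by rewrite divr_ge0 ?expR_ge0 ?exprn_ge0.
  have q20 : 0 <= 2 / (expR 1 * expR 1) :> R.
    by rewrite divr_ge0 ?mulr_ge0 ?expR_ge0.
  apply: le_trans (ler_wpM2r (ltW dlt0) (ler_pM q10 q20 q1 q2)) _.
  by rewrite mul1r mulrAC mul1r.
apply: le_trans (union_bound _ sample_pr_ge0) _.
apply: (@le_trans _ _ (\sum_(i < mD) dl)).
  apply: ler_sum => i _.
  have -> := pr_exploration i (fun w => ~ sup [set
    `|Jstar (rfe_mdp alg e dl (D_mdp P i) w) r - Jstar (D_mdp P i) r|
    | r in @rewards R S A H] <= e).
  by have := rfeP i; rewrite pr_complement ?rfe_pr_sum1 //; lra.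
rewrite sumr_const card_ord -[leLHS]mulr_natl dlE.
have m1 : 0 < mD%:R + 1 :> R by rewrite ltr_wpDl.
have -> : mD%:R * (dlt / (2 * (mD%:R + 1))) = dlt / 2 * (mD%:R / (mD%:R + 1)).
  by field; rewrite gt_eqF.
by rewrite ler_piMr ?divr_ge0 ?(ltW dlt0) // ler_pdivrMr // mul1r lerDl.
Qed.

End concentration.

(** * Sample and iteration bounds *)

Section asymptotics.
Context {R : realType}.
Implicit Types (x y : R) (xs : seq R).

Lemma ln_1D_ge0 x : 0 <= x -> 0 <= ln (1 + x).
Proof. by move=> x0; rewrite ln_ge0 // lerDl. Qed.

Lemma ln_1D_le x y : 0 <= x -> x <= y -> ln (1 + x) <= ln (1 + y).
Proof. by move=> x0 xy; rewrite ler_ln ?posrE; lra. Qed.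

Lemma ln_1DM x y : 0 <= x -> 0 <= y -> ln (1 + x * y) <= ln (1 + x) + ln (1 + y).
Proof.
move=> x0 y0; have xy : 0 <= x * y by rewrite mulr_ge0.
by rewrite -lnM ?ler_ln ?posrE; nra.
Qed.

Lemma ln_1DD x y : 0 <= x -> 0 <= y -> ln (1 + (x + y)) <= ln (1 + x) + ln (1 + y).
Proof.
move=> x0 y0; have xy : 0 <= x * y by rewrite mulr_ge0.
by rewrite -lnM ?ler_ln ?posrE; nra.
Qed.

Definition log_factor xs : R := 1 + \sum_(x <- xs) ln (1 + x).

Lemma log_factor_ge1 xs : all (>= 0) xs -> 1 <= log_factor xs.
Proof.
move=> /allP xs0; rewrite lerDl big_seq sumr_ge0 // => x /xs0.
exact: ln_1D_ge0.
Qed.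

Lemma softO_ge0 (C : R) k xs y : 0 <= C -> all (>= 0) xs -> 0 <= y ->
  0 <= softO C k xs y.
Proof.
move=> C0 xs0 y0; rewrite !mulr_ge0 // exprn_ge0 //.
exact: le_trans (log_factor_ge1 xs0).
Qed.

Section parameters.
Variables (S A H eps xi dlt : R) (mD mTC mPC : nat).
Hypotheses (S_ge0 : 0 <= S) (A_ge0 : 0 <= A) (H_ge1 : 1 <= H).
Hypotheses (eps_gt0 : 0 < eps) (xi_gt0 : 0 < xi) (dlt01 : 0 < dlt < 1).

Let logs := [:: S; A; H; eps^-1; xi^-1; mD%:R; mTC%:R; mPC%:R; ln dlt^-1].
Let L := log_factor logs.

Lemma ln_inv_ge0 : 0 <= ln dlt^-1.
Proof. by have /andP[d0 d1] := dlt01; rewrite ln_ge0 // invf_ge1 // ltW. Qed.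

Lemma logs_ge0 : all (>= 0) logs.
Proof.
rewrite /= S_ge0 A_ge0 (le_trans _ H_ge1) // !invr_ge0 !ler0n ln_inv_ge0.
by rewrite !ltW.
Qed.

Let L_ge1 : 1 <= L. Proof. exact: log_factor_ge1 logs_ge0. Qed.

Let L_terms : [/\ L = 1 + (ln (1 + S) + ln (1 + A) + ln (1 + H) + ln (1 + eps^-1)
    + ln (1 + xi^-1) + ln (1 + mD%:R) + ln (1 + mTC%:R) + ln (1 + mPC%:R)
    + ln (1 + ln dlt^-1)) &
  [/\ 0 <= ln (1 + S), 0 <= ln (1 + A), 0 <= ln (1 + H), 0 <= ln (1 + eps^-1) &
  [/\ 0 <= ln (1 + xi^-1), 0 <= ln (1 + mD%:R : R), 0 <= ln (1 + mTC%:R : R),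
      0 <= ln (1 + mPC%:R : R) & 0 <= ln (1 + ln dlt^-1)]]].
Proof.
have := logs_ge0; rewrite /= andbT => /and5P[h1 h2 h3 h4 /and5P[h5 h6 h7 h8 h9]].
split; last by split=> //; rewrite ?ln_1D_ge0 //; split; rewrite ln_1D_ge0.
by rewrite /L /log_factor !big_cons big_nil addr0 !addrA.
Qed.

Lemma ln_sources_le : ln (2 + mD%:R + mPC%:R * 2) <= 3 * L.
Proof.
have -> : 2 + mD%:R + mPC%:R * 2 = 1 + (1 + mD%:R + mPC%:R * 2) :> R by lra.
have [-> [? ? ? ? [? ? ? ? ?]]] := L_terms.
have := @ln_1DD (1 + mD%:R) (mPC%:R * 2) (addr_ge0 ler01 (ler0n _ _))
  (mulr_ge0 (ler0n _ _) (ler0n _ _)).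
have := @ln_1DD 1 mD%:R ler01 (ler0n _ _).
have := @ln_1DM mPC%:R 2 (ler0n _ _) (ler0n _ _).
have : ln (1 + 1) <= 1 :> R by apply: le_ln1Dx; lra.
have : ln (1 + 2) <= 2 :> R by apply: le_ln1Dx; lra.
lra.
Qed.

(* Numerals are unary, so large constants are written as products. *)
Lemma sample_size_le (n0 : R) : 1 <= S -> 1 <= A -> eps <= 2 * H -> xi <= H ->
  n0 <= 8 * (128 * H ^+ 2 / (eps * xi)) ^+ 2
    * (S * A * H + 2 + ln (2 + mD%:R + mPC%:R * 2) + ln dlt^-1) + 1 ->
  n0 <= (128 * 128 * 128)
    * (S * A * H ^+ 5 / (eps ^+ 2 * xi ^+ 2) * (1 + ln dlt^-1)) * L.
Proof.
move=> S1 A1 epsH xiH /le_trans; apply.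
have H1 := H_ge1; have L1 := L_ge1.
have l0 := ln_inv_ge0; set l := ln dlt^-1 in l0 *.
set lQ := ln _; have lQ_le : lQ <= 3 * L := ln_sources_le.
have lQ0 : 0 <= lQ.
  by rewrite ln_ge0 //; have : 0 <= mD%:R + mPC%:R * 2 :> R by []; lra.
have H0 : 0 < H by lra.
pose u := H ^+ 2 / (eps * xi).
(* Absorbs the [+ 1] of rounding up; this is where [eps <= 2 * H] and [xi <= H] enter. *)
have u_ge : 1 <= 4 * u ^+ 2.
  have : 1 <= 2 * u.
    rewrite /u mulrA ler_pdivlMr ?mulr_gt0 // mul1r expr2 mulrA.
    by apply: ler_pM => //; rewrite ltW.
  nra.
have -> : 128 * H ^+ 2 / (eps * xi) = 128 * u by rewrite /u mulrA.
have -> : S * A * H ^+ 5 / (eps ^+ 2 * xi ^+ 2) = S * A * H * u ^+ 2.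
  by rewrite /u; field; rewrite !gt_eqF.
have N1 : 1 <= S * A * H.
  by rewrite -[leLHS]mul1r -[X in X * _ <= _]mul1r !ler_pM.
move: (S * A * H) N1 => N N1.
have -> : (128 * 128 * 128) * (N * u ^+ 2 * (1 + l)) * L =
    u ^+ 2 * ((128 * 128 * 128) * (N * ((1 + l) * L))).
  by ring.
have -> : 8 * (128 * u) ^+ 2 * (N + 2 + lQ + l) =
    u ^+ 2 * ((128 * 32 * 32) * (N + 2 + lQ + l)).
  by ring.
have lL : 1 + l <= (1 + l) * L by rewrite ler_peMr //; lra.
have lL' : L <= (1 + l) * L by rewrite ler_peMl //; lra.
have NL : (1 + l) * L <= N * ((1 + l) * L) by rewrite ler_peMl //; lra.
have NL' : N <= N * ((1 + l) * L) by rewrite ler_peMr //; lra.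
have h : (128 * 32 * 32) * (N + 2 + lQ + l) + 4 <=
    (128 * 128 * 128) * (N * ((1 + l) * L)) by lra.
have := ler_wpM2l (sqr_ge0 u) h; lra.
Qed.

Let eps' := eps * xi / (128 * H).
Let dlt' := dlt / (2 * (mD%:R + 1)).

Lemma accuracy_gt0 : 0 < eps'.
Proof. by have H1 := H_ge1; rewrite divr_gt0 ?mulr_gt0 //; lra. Qed.

Lemma confidence_bounds : 0 < dlt' < 1.
Proof.
have /andP[d0 d1] := dlt01; have m0 : 0 <= mD%:R :> R by [].
have m1 : 0 < mD%:R + 1 :> R by lra.
apply/andP; split; first by rewrite divr_gt0 ?mulr_gt0.
by rewrite ltr_pdivrMr ?mulr_gt0 //; lra.
Qed.

Let ln_dlt' : ln dlt'^-1 = ln (1 + 1) + ln (1 + mD%:R) + ln dlt^-1.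
Proof.
have /andP[d0 d1] := dlt01; have m0 : 0 <= mD%:R :> R by [].
have m1 : 0 < 1 + mD%:R :> R by lra.
rewrite -lnM ?posrE // -lnM ?posrE ?mulr_gt0 ?invr_gt0 //.
congr ln; rewrite /dlt' (addrC _ 1); field; rewrite !gt_eqF //; lra.
Qed.

(** The factors of the derived accuracy and confidence split into logarithms already in [L], each
    used at most twice. The constants 1, 128 (bounding ln 129) and 1 add up to 130. *)
Lemma exploration_logs_le :
  log_factor [:: S; A; H; eps'^-1; ln dlt'^-1] <= 130 * L.
Proof.
have H1 := H_ge1; have L1 := L_ge1.
have d'0 : 0 <= ln dlt'^-1.
  by have /andP[? ?] := confidence_bounds; rewrite ln_ge0 // invf_ge1 // ltW.
have l0 := ln_inv_ge0; have m0 : 0 <= mD%:R :> R by [].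
have H0 : 0 <= H by lra.
have ln2 : ln (1 + 1) <= 1 :> R by apply: le_ln1Dx; lra.
have ln20 : 0 <= ln (1 + 1) :> R by apply: ln_1D_ge0.
have e0 : 0 <= eps^-1 by rewrite invr_ge0 ltW.
have x0 : 0 <= xi^-1 by rewrite invr_ge0 ltW.
have h1 : ln (1 + eps'^-1) <= 128 + ln (1 + H) + ln (1 + eps^-1) + ln (1 + xi^-1).
  have -> : eps'^-1 = 128 * H * eps^-1 * xi^-1.
    by rewrite /eps'; field; rewrite !gt_eqF //; lra.
  have := @ln_1DM (128 * H * eps^-1) xi^-1; rewrite !mulr_ge0 // => /(_ isT x0).
  have := @ln_1DM (128 * H) eps^-1; rewrite !mulr_ge0 // => /(_ isT e0).
  have := @ln_1DM 128 H; rewrite ler0n => /(_ isT H0).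
  have : ln (1 + 128) <= 128 :> R by apply: le_ln1Dx; lra.
  lra.
have h2 : ln (1 + ln dlt'^-1) <= 1 + ln (1 + mD%:R) + ln (1 + ln dlt^-1).
  have m10 := ln_1D_ge0 m0.
  rewrite ln_dlt'.
  have := @ln_1DD (ln (1 + 1) + ln (1 + mD%:R)) (ln dlt^-1) (addr_ge0 ln20 m10) l0.
  have := @ln_1DD (ln (1 + 1)) (ln (1 + mD%:R)) ln20 m10.
  have := ln_1D_le ln20 ln2.
  have : ln (1 + ln (1 + mD%:R)) <= ln (1 + mD%:R) :> R.
    by apply: ln_1D_le => //; apply: le_ln1Dx; lra.
  lra.
have [-> [? ? ? ? [? ? ? ? ?]]] := L_terms.
rewrite /log_factor !big_cons big_nil addr0; lra.
Qed.

(** [ln dlt'^-1] exceeds [ln dlt^-1] by at most [L], which is at most [S * L] if [S >= 1]; this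
    costs the additional power of [L]. The absolute value is there because [C0] may be negative. *)
Lemma exploration_size_le (C0 : R) (k0 : nat) (n1 : R) :
  S = 0 \/ 1 <= S ->
  n1 <= softO C0 k0 [:: S; A; H; eps'^-1; ln dlt'^-1]
    (S * A * H ^+ 3 / eps' ^+ 2 * (S + ln dlt'^-1)) ->
  n1 <= `|C0| * (128 * 256) * 130 ^+ k0 *
    (S * A * H ^+ 5 / (eps ^+ 2 * xi ^+ 2) * (S + ln dlt^-1)) * L ^+ k0.+1.
Proof.
have H1 := H_ge1; have L1 := L_ge1.
move=> S01 /le_trans; apply; rewrite /softO -/(log_factor _).
have H0 : 0 < H by lra.
have l0 := ln_inv_ge0.
have d'0 : 0 <= ln dlt'^-1.
  by have /andP[? ?] := confidence_bounds; rewrite ln_ge0 // invf_ge1 // ltW.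
have L'1 : 1 <= log_factor [:: S; A; H; eps'^-1; ln dlt'^-1].
  apply: log_factor_ge1.
  by rewrite /= S_ge0 A_ge0 ltW // d'0 invr_ge0 ltW // accuracy_gt0.
have Lk : log_factor [:: S; A; H; eps'^-1; ln dlt'^-1] ^+ k0 <=
    130 ^+ k0 * L ^+ k0.
  rewrite -exprMn lerXn2r ?nnegrE ?exploration_logs_le //; first by lra.
  by rewrite mulr_ge0 //; lra.
have -> : S * A * H ^+ 3 / eps' ^+ 2 =
    (128 * 128) * (S * A * H ^+ 5 / (eps ^+ 2 * xi ^+ 2)).
  by rewrite /eps'; field; rewrite !gt_eqF.
set w := S * A * H ^+ 5 / (eps ^+ 2 * xi ^+ 2).
have w0 : 0 <= w by rewrite divr_ge0 ?mulr_ge0 ?exprn_ge0 // ltW.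
have main : w * (S + ln dlt'^-1) <= 2 * (w * (S + ln dlt^-1) * L).
  case: S01 => [S0|S1]; first by rewrite /w S0 !mul0r mulr0.
  rewrite -mulrA mulrCA ler_wpM2l // ln_dlt'.
  have ln2 : ln (1 + 1) <= 1 :> R by apply: le_ln1Dx; lra.
  have LmD : ln (1 + mD%:R) <= L - 1 by have [-> [? ? ? ? [? ? ? ? ?]]] := L_terms; lra.
  have := ler_peMl (le_trans ler01 L_ge1) S1.
  have := ler_peMr l0 L_ge1; have := ler_peMr (le_trans ler01 S1) L_ge1.
  lra.
set LL := log_factor _ in L'1 Lk *.
have step1 : (128 * 128) * w * (S + ln dlt'^-1) <=
    (128 * 256) * (w * (S + ln dlt^-1) * L) by lra.
have y0 : 0 <= (128 * 128) * w * (S + ln dlt'^-1).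
  by apply: mulr_ge0; [apply: mulr_ge0 | apply: addr_ge0].
apply: (@le_trans _ _ (`|C0| * ((128 * 128) * w * (S + ln dlt'^-1)) * LL ^+ k0)).
  have LLk0 : 0 <= LL ^+ k0 by rewrite exprn_ge0 //; lra.
  by rewrite (ler_wpM2r LLk0) // (ler_wpM2r y0) // ler_norm.
apply: (@le_trans _ _ (`|C0| * ((128 * 256) * (w * (S + ln dlt^-1) * L))
    * (130 ^+ k0 * L ^+ k0))).
  apply: ler_pM => //.
  - by rewrite mulr_ge0.
  - by rewrite exprn_ge0 //; lra.
  - by rewrite ler_wpM2l.
by rewrite exprS le_eqVlt; apply/orP; left; apply/eqP; ring.
Qed.

End parameters.

Lemma iter_bound_ge0 (S A H m eps xi : R) : 0 < eps -> 0 < xi ->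
  0 <= iter_bound S A H m eps xi * slack_factor S A H xi.
Proof.
move=> e0 x0; rewrite mulr_ge0 //; last by rewrite le_max ler01.
rewrite mulr_ge0 ?sqr_ge0 // mulr_ge0 //.
  by rewrite divr_ge0 ?powR_ge0 // mulr_ge0 ?exprn_ge0 // ltW.
by rewrite addr_ge0 ?sqrtr_ge0 // divr_ge0 ?sqrtr_ge0 // ltW.
Qed.

Lemma iterations_le (S A H m eps xi s K0 : R) :
  1 <= S -> 1 <= A -> 1 <= H -> 0 <= m -> 0 < eps <= 2 * H -> 0 < xi ->
  s = 4 * H / xi + Num.sqrt ((4 * H / xi) ^+ 2 + S * A * H / 4) ->
  K0 <= 32 * H * (1 + s * Num.sqrt m) ^+ 2 * (S * A * H + s ^+ 2) / eps ^+ 2 + 1 ->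
  K0 <= (64 * 64 * 64) * (iter_bound S A H m eps xi * slack_factor S A H xi).
Proof.
move=> S1 A1 H1 m0 /andP[e0 e2] x0 sE /le_trans; apply.
have H0 : 0 < H by lra.
have SA1 : 1 <= S * A by rewrite -[leLHS]mul1r ler_pM.
have SAH1 : H <= S * A * H by rewrite -[leLHS]mul1r ler_wpM2r // ltW.
pose a := H / xi.
have a0 : 0 <= a by rewrite divr_ge0 // ltW.
have s0 : 0 <= s by rewrite sE addr_ge0 ?sqrtr_ge0 // divr_ge0 ?mulr_ge0 // ltW.
(* [(4 a + t)^2 <= 2 (4 a)^2 + 2 t^2], where [t] is the square root. *)
have s2 : s ^+ 2 <= 64 * a ^+ 2 + S * A * H / 2.
  have : s = 4 * a + Num.sqrt ((4 * a) ^+ 2 + S * A * H / 4).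
    by rewrite sE /a mulrA.
  have b0 : 0 <= (4 * a) ^+ 2 + S * A * H / 4.
    by rewrite addr_ge0 ?sqr_ge0 // divr_ge0 //; lra.
  have := sqr_sqrtr b0; move: (Num.sqrt _) => t t2 ->.
  by have := sqr_ge0 (4 * a - t); nra.
pose q := (1 + s * Num.sqrt m) ^+ 2.
pose q' := (1 + Num.sqrt (H * m * (H / xi ^+ 2 + S * A))) ^+ 2.
have q1 : 1 <= q.
  by rewrite -[leLHS](expr1n _ 2) lerXn2r ?nnegrE ?lerDl ?addr_ge0 ?mulr_ge0 ?sqrtr_ge0.
have qq' : q <= 64 * q'.
  set z := H * m * (H / xi ^+ 2 + S * A).
  have z0 : 0 <= z.
    by rewrite !mulr_ge0 ?addr_ge0 ?divr_ge0 ?exprn_ge0 //; lra.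
  have sm : s * Num.sqrt m <= 8 * Num.sqrt z.
    rewrite -(@ler_pXn2r _ 2) ?nnegrE ?mulr_ge0 ?sqrtr_ge0 //.
    rewrite !exprMn !sqr_sqrtr //.
    have -> : z = m * (a ^+ 2 + S * A * H) by rewrite /z /a; field; rewrite gt_eqF.
    have : s ^+ 2 * m <= (64 * a ^+ 2 + S * A * H / 2) * m by rewrite ler_wpM2r.
    have : 0 <= S * A * H * m by rewrite mulr_ge0 //; lra.
    lra.
  have -> : 64 * q' = (8 * (1 + Num.sqrt z)) ^+ 2 by rewrite /q' exprMn; lra.
  rewrite lerXn2r ?nnegrE ?addr_ge0 ?mulr_ge0 ?addr_ge0 ?sqrtr_ge0 //; lra.
pose T := H ^+ 3 / xi ^+ 2 + S * A * H ^+ 2.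
have T0 : 0 <= T by rewrite addr_ge0 // ?divr_ge0 ?mulr_ge0 ?exprn_ge0 //; lra.
have main : T / eps ^+ 2 * q' <= iter_bound S A H m eps xi * slack_factor S A H xi.
  rewrite /iter_bound -/q' [leRHS]mulrAC ler_wpM2r ?sqr_ge0 //.
  have -> : H `^ (5 / 2) = H ^+ 2 * Num.sqrt H.
    have -> : 5 / 2 = 2 + 2^-1 :> R by lra.
    by rewrite powRD ?gt_eqF ?implybT // powR_mulrn ?powR12_sqrt // ltW.
  pose u := Num.sqrt (S * A); pose v := Num.sqrt H / xi.
  pose B := H ^+ 2 * Num.sqrt H / (xi * eps ^+ 2).
  (* [B * v] is exactly the first summand of [T / eps ^+ 2], while [B * u] has to be multiplied by
     [x] to reach the second; this is the origin of [slack_factor]. *)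
  pose x := xi * Num.sqrt (S * A / H).
  have B0 : 0 <= B.
    by rewrite divr_ge0 ?mulr_ge0 ?sqrtr_ge0 ?exprn_ge0 // ltW.
  have v0 : 0 <= v by rewrite divr_ge0 ?sqrtr_ge0 // ltW.
  have sH : Num.sqrt H ^+ 2 = H by rewrite sqr_sqrtr // ltW.
  have su : u ^+ 2 = S * A by rewrite sqr_sqrtr //; lra.
  have sH0 : 0 < Num.sqrt H by rewrite sqrtr_gt0.
  have Bv : B * v = H ^+ 3 / xi ^+ 2 / eps ^+ 2.
    transitivity (H ^+ 2 * (Num.sqrt H ^+ 2) / xi ^+ 2 / eps ^+ 2).
      by rewrite /B /v; field; rewrite !gt_eqF.
    by rewrite sH -exprSr.
  have Bu : B * (u * x) = S * A * H ^+ 2 / eps ^+ 2.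
    rewrite /x sqrtrM; last by lra.
    rewrite sqrtrV ?(ltW H0) // -/u.
    transitivity (u ^+ 2 * H ^+ 2 / eps ^+ 2); last by rewrite su.
    by rewrite /B; field; rewrite !gt_eqF.
  have -> : T / eps ^+ 2 = B * (u * x + v).
    by rewrite mulrDr Bu Bv /T mulrDl addrC.
  rewrite -/v -/u -/B -[leRHS]mulrA ler_wpM2l // mulrDl lerD //.
    by rewrite ler_wpM2l ?sqrtr_ge0 // le_max lexx orbT.
  by rewrite ler_peMr // le_max lexx.
have hT : H * (S * A * H + s ^+ 2) <= 64 * T.
  have -> : T = H * (a ^+ 2 + S * A * H) by rewrite /T /a; field; rewrite gt_eqF.
  rewrite [leRHS]mulrCA ler_pM2l //; lra.
have c0 : 0 <= 64 * 64 * 64 :> R.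
  by apply: mulr_ge0; [apply: mulr_ge0 |]; exact: ler0n.
apply: le_trans (ler_wpM2l c0 main).
rewrite -/q; move: q q' T q1 qq' hT T0 {main} => q q' T q1 qq' hT T0.
have e20 : 0 < eps ^+ 2 by rewrite exprn_gt0.
(* Lets the [+ 1] of rounding be absorbed by doubling: 64 * 64 * 64 is twice the 32 * 64 * 64
   obtained below. *)
have x1 : 1 <= 32 * H * q * (S * A * H + s ^+ 2) / eps ^+ 2.
  rewrite ler_pdivlMr // mul1r.
  apply: (@le_trans _ _ (32 * H * 1 * H)); first by nra.
  rewrite ler_pM ?mulr_ge0 //; try lra; first by rewrite ler_wpM2l //; lra.
  by have := sqr_ge0 s; lra.
have : 32 * H * q * (S * A * H + s ^+ 2) / eps ^+ 2 <=
    (128 * 32 * 32) * (T / eps ^+ 2 * q').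
  have -> : (128 * 32 * 32) * (T / eps ^+ 2 * q') =
      (32 * (64 * q') * (64 * T)) / eps ^+ 2.
    by ring.
  rewrite ler_pM2r ?invr_gt0 //.
  have -> : 32 * H * q * (S * A * H + s ^+ 2) = 32 * q * (H * (S * A * H + s ^+ 2)).
    by ring.
  apply: ler_pM; [lra | | lra | exact: hT].
  by apply: mulr_ge0; [exact: ltW | apply: addr_ge0; [lra | exact: sqr_ge0]].
move: (_ / eps ^+ 2) x1 => y; lra.
Qed.

End asymptotics.

(** * Assembly of the final result *)

Lemma emp_visit_occupancy (R : realType) (S A : finType) (H mD mPC : nat)
    (n : source mD mPC -> nat) (N : nat) (w : sample S A H n N) q :
  (0 < n q)%N -> occupancy (emp_visit R w q).
Proof.
move=> n0; rewrite /emp_visit scaler_sumr.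
apply: (occupancy_convex (p := fun=> (n q)%:R^-1)) => [j||j].
- by rewrite invr_ge0.
- by rewrite sumr_const card_ord -[LHS]mulr_natl divff // pnatr_eq0 -lt0n.
- exact: visit_traj_occupancy.
Qed.

Lemma problem_nonempty (R : realType) (S A : finType) (H mD mTC mPC : nat)
    (P : problem R S A H mD mTC mPC) :
  (0 < H)%N -> (0 < #|S|)%N /\ (0 < #|A|)%N.
Proof.
move=> H0; split; first by apply/card_gt0P; exists (init (tgt P)).
rewrite lt0n; apply/negP => /eqP/card0_eq A0.
have := fdist_sum1 (tgt_pol1 P (init (tgt P)) (Ordinal H0)).
rewrite big_pred0 => [/eqP|a]; first by rewrite eq_sym oner_eq0.
by have := A0 a; rewrite inE.
Qed.

Theorem theorem5p1 (R : realType) (C0 : R) (k0 : nat) :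
  exists (C : R) (k : nat),
  forall (S A : finType) (H : nat) (rfx : rfe_alg R S A H),
  rfe_guarantee C0 k0 rfx ->
  forall (mD mTC mPC : nat) (eps delta xi s alpha : R),
  let SAH := #|S|%:R * #|A|%:R * H%:R : R in
  let m := (mD + mTC + mPC)%:R : R in
  let logs := [:: #|S|%:R; #|A|%:R; H%:R; eps^-1; xi^-1;
                  mD%:R; mTC%:R; mPC%:R; ln delta^-1] : seq R in
  0 < eps <= 2 * H%:R -> 0 < delta < 1 -> 0 < xi ->
  ((mD + mTC + mPC)%N = 0%N -> xi <= H%:R) ->
  s = 4 * H%:R / xi + Num.sqrt ((4 * H%:R / xi) ^+ 2 + SAH / 4) ->
  alpha = eps / (16 * H%:R * (1 + s * Num.sqrt m) ^+ 2) ->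
  exists (n0 K0 : nat) (eps' delta' : R),
  [/\ n0%:R <= softO C k logs
        (#|S|%:R * #|A|%:R * H%:R ^+ 5 / (eps ^+ 2 * xi ^+ 2)
         * (1 + ln delta^-1)),
      0 < eps' /\ 0 < delta' < 1,
      (rfe_num rfx eps' delta')%:R <= softO C k logs
        (#|S|%:R * #|A|%:R * H%:R ^+ 5 / (eps ^+ 2 * xi ^+ 2)
         * (#|S|%:R + ln delta^-1)),
      K0%:R <= C * (iter_bound #|S|%:R #|A|%:R H%:R m eps xi
                    * slack_factor #|S|%:R #|A|%:R H%:R xi) &
      forall (P : problem R S A H mD mTC mPC) (rstar : reward R S A H)
        (plan : mdp R S A H -> reward R S A H -> policy R S A H)
        (n : source mD mPC -> nat) (K : nat),
      slater P xi -> feasible P rstar -> optimal_planner plan ->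
      (forall q, n0 <= n q)%N -> (K0 <= K)%N ->
      1 - delta <=
      pr (sample_pr P rfx eps' delta' (n := n) (N := rfe_num rfx eps' delta'))
        (fun w =>
           loss P rstar (robrel_x P plan rfx eps' delta' alpha s K w)
             <= uninformativeness P + eps /\
           `|uninformativeness P - robrel_I P plan rfx eps' delta' alpha s K w|
             <= eps)].
Proof.
pose cS : R := 128 * 128 * 128.
pose cE : R := `|C0| * (128 * 256) * 130 ^+ k0.
pose cK : R := 64 * 64 * 64.
have cS0 : 0 <= cS by apply: mulr_ge0; [apply: mulr_ge0 |]; exact: ler0n.
have cK0 : 0 <= cK by apply: mulr_ge0; [apply: mulr_ge0 |]; exact: ler0n.
have cE0 : 0 <= cE.
  by apply: mulr_ge0; [apply: mulr_ge0 => //; apply: mulr_ge0 |]; rewrite ?exprn_ge0.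
exists (cS + cE + cK), k0.+1 => S A H rfx rfeG mD mTC mPC eps delta xi s alpha.
move=> SAH m logs eps_bound d01 x0 xiH0 sE alphaE.
have [e0 e2] := andP eps_bound.
have H_gt0 : (0 < H)%N by rewrite -(ltr0n R); lra.
have H1 : 1 <= H%:R :> R by rewrite ler1n.
have H0 : 0 < H%:R :> R by lra.
have l0 := ln_inv_ge0 d01.
have S0 : 0 <= #|S|%:R :> R by [].
have A0 : 0 <= #|A|%:R :> R by [].
have logs0 : all (>= 0) logs by exact: logs_ge0.
have L1 := log_factor_ge1 logs0.
have L0 : 0 <= log_factor logs by lra.
pose w := #|S|%:R * #|A|%:R * H%:R ^+ 5 / (eps ^+ 2 * xi ^+ 2) : R.
have w0 : 0 <= w by rewrite divr_ge0 ?mulr_ge0 ?exprn_ge0 // ltW.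
(* One accuracy is demanded of the datasets and of the explorations alike. *)
pose eps' := eps * xi / (128 * H%:R).
pose delta' := delta / (2 * (mD%:R + 1)).
have eps'0 : 0 < eps' by exact: accuracy_gt0.
have d'01 : 0 < delta' < 1 by exact: confidence_bounds.
have [num_le rfeP] := rfeG eps' delta' eps'0 d'01.
have bound0 (y : R) : 0 <= y -> 0 <= softO (cS + cE + cK) k0.+1 logs y.
  by move=> y0; apply: softO_ge0 => //; rewrite !addr_ge0.
have C_le (y : R) : 0 <= y ->
    cS * y * log_factor logs <= softO (cS + cE + cK) k0.+1 logs y /\
    cE * y * log_factor logs ^+ k0.+1 <= softO (cS + cE + cK) k0.+1 logs y.
  move=> y0; rewrite /softO -/(log_factor logs); split; last first.
    by rewrite ler_wpM2r ?exprn_ge0 // ler_wpM2r //; lra.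
  apply: ler_pM => //; first exact: mulr_ge0.
    by rewrite ler_wpM2r //; lra.
  by rewrite exprS ler_peMr // exprn_ege1.
have num_bound : (rfe_num rfx eps' delta')%:R <=
    softO (cS + cE + cK) k0.+1 logs (w * (#|S|%:R + ln delta^-1)).
  apply: le_trans (proj2 (C_le _ _)); last by rewrite mulr_ge0 ?addr_ge0.
  apply: exploration_size_le => //.
  by case: (posnP #|S|) => [->|S1]; [left | right; rewrite ler1n].
have iter0 := iter_bound_ge0 #|S|%:R #|A|%:R H%:R m e0 x0.
(* The sizes are chosen before the problem. In the excluded cases no problem satisfies Slater's
   condition with this [xi], so zero samples and iterations do; the bound on exploration is already
   established. *)
have [/and3P[S_gt0 A_gt0 xiH]|vacuous] :=
    boolP [&& (0 < #|S|)%N, (0 < #|A|)%N & xi <= H%:R]; last first.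
  exists 0%N, 0%N, eps', delta'; split=> //.
  - by rewrite bound0 // mulr_ge0 // addr_ge0.
  - by rewrite mulr_ge0 // !addr_ge0.
  - move=> P rstar plan n K sl; have [S_gt0 A_gt0] := problem_nonempty P H_gt0.
    case/negP: vacuous; rewrite S_gt0 A_gt0 /=.
    have [/xiH0 //|] := eqVneq (mD + mTC + mPC)%N 0%N.
    rewrite -lt0n => mpos.
    have /card_gt0P[c _] : (0 < #|{: feedback mD mTC mPC}|)%N.
      by rewrite !card_sum !card_ord.
    exact: slater_le sl c.
have S1 : 1 <= #|S|%:R :> R by rewrite ler1n.
have A1 : 1 <= #|A|%:R :> R by rewrite ler1n.
have m0 : 0 <= m by rewrite ler0n.
(* [x1] solves the budget of [sample_concentration] for the dataset size, with [2 + mD + 2 mPC]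
   sources; [x2] is the iteration count required by [step_size_gap]. *)
pose x1 := 8 * (128 * H%:R ^+ 2 / (eps * xi)) ^+ 2
  * (SAH + 2 + ln (2 + mD%:R + mPC%:R * 2) + ln delta^-1).
pose x2 := 32 * H%:R * (1 + s * Num.sqrt m) ^+ 2 * (SAH + s ^+ 2) / eps ^+ 2.
have SAH0 : 0 <= SAH by rewrite !mulr_ge0.
have lQ0 : 0 <= ln (2 + mD%:R + mPC%:R * 2) :> R.
  have : 0 <= mD%:R + mPC%:R * 2 :> R by rewrite addr_ge0 ?mulr_ge0.
  by rewrite -addrA => h; rewrite ln_ge0 //; lra.
have x10 : 0 <= x1.
  apply: mulr_ge0; first by rewrite mulr_ge0 ?sqr_ge0.
  by apply: addr_ge0 => //; apply: addr_ge0 => //; apply: addr_ge0.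
have x20 : 0 <= x2.
  apply: divr_ge0; last exact: sqr_ge0.
  apply: mulr_ge0; last by apply: addr_ge0 => //; exact: sqr_ge0.
  by apply: mulr_ge0; [apply: mulr_ge0 | exact: sqr_ge0].
have /andP[t1 t1'] := truncn_itv x10; have /andP[t2 t2'] := truncn_itv x20.
exists (Num.truncn x1).+1, (Num.truncn x2).+1, eps', delta'; split=> //.
- apply: le_trans (proj1 (C_le _ _)); last by rewrite mulr_ge0 ?addr_ge0.
  by apply: sample_size_le => //; rewrite -natr1 lerD2r.
- apply: (@le_trans _ _ (cK * (iter_bound #|S|%:R #|A|%:R H%:R m eps xi
    * slack_factor #|S|%:R #|A|%:R H%:R xi))); last by rewrite ler_wpM2r //; lra.
  by apply: (iterations_le (s := s)) => //; rewrite -natr1 lerD2r.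
move=> P rstar plan n K sl fr planP n_ge K_ge.
have tauH : eps' / H%:R = eps * xi / (128 * H%:R ^+ 2).
  by rewrite /eps'; field; rewrite !gt_eqF.
have d0 : 0 < delta by case/andP: d01.
have t02 : 0 <= eps' / H%:R <= 2.
  rewrite tauH; apply/andP; split.
    by apply: divr_ge0; apply: mulr_ge0; rewrite ?exprn_ge0 // ltW.
  by rewrite ler_pdivrMr ?mulr_gt0 ?exprn_gt0 //; nra.
have budget : #|{: S * A * 'I_H}|%:R + 2 + ln #|{: source mD mPC}|%:R + ln delta^-1
    <= (Num.truncn x1).+1%:R * (eps' / H%:R) ^+ 2 / 8.
  have -> : #|{: S * A * 'I_H}|%:R = SAH by rewrite !card_prod card_ord !natrM.
  have -> : #|{: source mD mPC}|%:R = 2 + mD%:R + mPC%:R * 2 :> R.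
    by rewrite !card_sum card_prod !card_ord card_bool !natrD natrM.
  rewrite tauH.
  have -> : SAH + 2 + ln (2 + mD%:R + mPC%:R * 2) + ln delta^-1 =
      x1 * (eps * xi / (128 * H%:R ^+ 2)) ^+ 2 / 8.
    by rewrite /x1; field; rewrite !gt_eqF.
  by rewrite ler_pM2r ?invr_gt0 // ler_wpM2r ?sqr_ge0 // ltW.
have conc := (@sample_concentration _ _ _ _ _ _ _ P rfx eps' delta' n
  (rfe_num rfx eps' delta') delta eps' (Num.truncn x1).+1 H_gt0 isT n_ge d0 t02 erefl
  (fun i => rfeP (D_mdp P i)) budget).
apply: le_trans conc _.
apply: pr_le => [u|u [dv_close MD_close]]; first exact: sample_pr_ge0.
apply: (@robrel_correct _ _ _ _ _ _ _ P plan (emp_visit R u)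
  (emp_mdp P rfx eps' delta' u) eps xi s alpha eps' K rstar) => //.
- by rewrite x0.
- exact: leq_trans K_ge.
- by apply: le_trans (ltW t2') _; rewrite ler_nat.
- by move=> q; apply: emp_visit_occupancy; exact: leq_trans (n_ge q).
- by move=> i r br; exact: (rfe_Jstar_close planP br (MD_close i)).
Qed.
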